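(* Assume that there exists a continuous function $f\colon\mathbb{R}^d\to\mathbb{R}$ such that $$g(x)=\int_{\mathbb{R}^d} f(y)\,G_r(x,dy)\quad\text{for all }x\in\mathbb{R}^d,$$ and that the value function $V\colon\mathbb{R}^d\to\mathbb{R}$ is of the form $$V(x)=\int_{\mathcal S} f(y)\,G_r(x,dy),\quad x\in\mathbb{R}^d,$$ where $\mathcal S=\{x\in\mathbb{R}^d: V(x)=g(x)\}$ is the stopping set, and that the hitting time $h_{\mathcal S}$ is an optimal stopping time. Furthermore, let $\mathbb{U}$ be a class of nonempty closed subsets of $\mathbb{R}^d$ containing $\mathcal S$ (i.e. $\mathcal S\in\mathbb{U}$) such that (a) $f(y)>0$ for all $U\in\mathbb{U}$ and $y\in U$; (b) for all $U,U'\in\mathbb{U}$ the following implications hold true: (i) if $\mathbf{P}_x\big(\lambda(\{t\le h_{U^c}: X_t\notin U'\})=0\big)=1$ for all $x\in U\cap U'$, then $U\subseteq U'$; (ii) if $\mathbf{P}_x\big(\lambda(\{t\le h_{U}: X_t\in U'\})=0\big)=1$ for all $x\in U^c$, then $U'\subseteq U$. Here $\lambda$ denotes Lebesgue measure. Then $U=\mathcal S$ is the unique set in the class $\mathbb{U}$ which satisfies $$\int_{U^c} f(y)\,G_r(x,dy)=0\quad\text{for all }x\in\partial U .$$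
   Context: $X=\{X_t\}_{t\ge0}$ is a multidimensional diffusion: a homogeneous nonterminating strong Markov process with continuous trajectories and values in $\mathbb{R}^d$, satisfying the Feller property, with its usual (completed, right-continuous) filtration $\mathbb{F}=\{\mathcal{F}_t\}_{t\geq 0}$, so that hitting times of Borel sets are stopping times. $\mathbf{P}_x$, $\mathbf{E}_x$ denote probability and expectation given $X_0=x$. The discount rate $r>0$ is fixed and $g\colon\mathbb{R}^d\to[0,\infty)$ is a continuous reward function. The optimal stopping problem has value function $$V(x)=\sup_\tau \mathbf{E}_x\big(e^{-r\tau}g(X_\tau)\big),$$ the supremum being over all $\mathbb{F}$-stopping times; a stopping time $\tau^*$ is optimal if it attains the supremum for every $x$. On $\{\tau=\infty\}$ one sets $e^{-r\tau}g(X_\tau):=\limsup_{t\to\infty}e^{-rt}g(X_t)$. The $r$-Green kernel is the measure $G_r(x,H):=\int_0^\infty e^{-rt}\,\mathbf{P}_x(X_t\in H)\,dt$, $H\subseteq\mathbb{R}^d$ Borel. Integrals against $G_r(x,dy)$ are understood to be absolutely convergent. For a Borel set $S$, $h_S:=\inf\{t\ge0: X_t\in S\}$ (with $\inf\emptyset=\infty$), $S^c=\mathbb{R}^d\setminus S$, and $\partial S$ is the topological boundary. *)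

(* Defs.v *)
From HB Require Import structures.
From mathcomp Require Import all_boot all_order all_algebra.
From mathcomp Require Import all_classical all_reals all_analysis.
From mathcomp Require Import measurable_realfun.

Set Implicit Arguments.
Unset Strict Implicit.
Unset Printing Implicit Defensive.

Import Order.TTheory GRing.Theory Num.Theory.
Import numFieldNormedType.Exports.

Local Open Scope classical_set_scope.
Local Open Scope ring_scope.

(* R^n with its Borel sigma-algebra; the carrier is 'rV[R]_n itself. *)
Notation borelRV R n := (g_sigma_algebraType (@open 'rV[R]_n)).

Definition boundary {T : topologicalType} (A : set T) : set T :=
  closure A `\` interior A.

Section family_of_laws.
Context d (Omega : measurableType d) (R : realType) (n : nat).
(* P x is the law of the process started at x.  Time is indexed by R, but
   only X t with 0 <= t is ever used. *)
Variables (P : 'rV[R]_n -> probability Omega R) (X : R -> Omega -> 'rV[R]_n).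

Definition natural_filtration (t : R) : set (set Omega) :=
  <<s [set A | exists (s : R) (H : set (borelRV R n)),
         [/\ 0 <= s <= t, measurable H & A = X s @^-1` H]] >>.

Definition natural_sigma : set (set Omega) :=
  <<s [set A | exists (s : R) (H : set (borelRV R n)),
         [/\ 0 <= s, measurable H & A = X s @^-1` H]] >>.

(* The usual (universal) augmentation of the natural filtration: for every
   initial law mu, the sigma-algebra at time s is completed by the null sets
   of the law P_mu = \int P_x mu(dx) on natural_sigma; one then intersects
   over s > t (right-continuity) and over mu. *)
Definition usual_filtration (t : R) : set (set Omega) :=
  [set A | forall (mu : probability (borelRV R n) R) (s : R), t < s ->
     exists B N : set Omega,
       [/\ natural_filtration s B, natural_sigma N,
           (\int[mu]_x P x N = 0)%E & A `+` B `<=` N]].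

Definition stopping_time (tau : Omega -> \bar R) : Prop :=
  (forall w, 0 <= tau w)%E /\
  (forall t : R, 0 <= t -> usual_filtration t [set w | (tau w <= t%:E)%E]).

Definition stopped_sigma (tau : Omega -> \bar R) : set (set Omega) :=
  [set A | measurable A /\
     forall t : R, 0 <= t ->
       usual_filtration t (A `&` [set w | (tau w <= t%:E)%E])].

(* P_x(X_(tau+t) \in H | F_tau) = P_(X_tau)(X_t \in H) on {tau < +oo},
   with the conditional probability spelled out by its defining integrals;
   the transition law on the right does not depend on tau (homogeneity). *)
Definition strong_markov : Prop :=
  forall tau, stopping_time tau ->
  forall (x : 'rV[R]_n) (t : R) (H : set (borelRV R n)) (A : set Omega),
    0 <= t -> measurable H -> stopped_sigma tau A ->
    P x (A `&` [set w | (tau w < +oo)%E /\ H (X (fine (tau w) + t) w)]) =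
    (\int[P x]_(w in A `&` [set w | tau w < +oo])
        P (X (fine (tau w)) w) (X t @^-1` H))%E.

Definition feller : Prop :=
  forall (t : R) (phi : 'rV[R]_n -> R),
    0 <= t -> continuous phi -> (exists M, forall y, `|phi y| <= M) ->
    continuous (fun x : 'rV[R]_n => \int[P x]_w phi (X t w)).

End family_of_laws.

(* The values lie in R^n at all times, so that the process never terminates.
   The sigma-algebra carried by Omega, on which each P x is defined, is
   assumed to be already completed: it contains the usual filtration. *)
Record diffusion d (Omega : measurableType d) (R : realType) (n : nat) :=
  Diffusion {
    law : 'rV[R]_n -> probability Omega R ;
    path : R -> Omega -> 'rV[R]_n ;
    path_continuous : forall w,
      {within `[0, +oo[%classic, continuous (fun t : R => path t w)} ;
    usual_filtration_measurable : forall t : R, 0 <= t ->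
      usual_filtration law path t `<=` measurable ;
    law_start : forall x, law x [set w | path 0 w = x] = 1%E ;
    law_measurable : forall B, natural_sigma path B ->
      measurable_fun [set: borelRV R n] (law^~ B : borelRV R n -> \bar R) ;
    diffusion_strong_markov : strong_markov law path ;
    diffusion_feller : feller law path
  }.

Section green_kernel.
Context d (Omega : measurableType d) (R : realType) (n : nat).
Variables (D : diffusion Omega R n).
Implicit Types (H : set (borelRV R n)) (t : R) (x : 'rV[R]_n).

Local Notation P := (law D).
Local Notation X := (path D).

Lemma natural_filtration_usual t :
  natural_filtration X t `<=` usual_filtration P X t.
Proof.
move=> A FA mu s ts; exists A, set0; split.
- move: A FA; apply: sub_sigma_algebra2 => _ [u [H [/andP[u0 ut] mH ->]]].
  by exists u, H; rewrite u0 (le_trans ut (ltW ts)).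
- exact: sigma_algebra0.
- by rewrite (eq_integral (cst 0%E)) ?integral0// => y _; rewrite measure0.
- by rewrite setYK.
Qed.

Lemma path_measurable t H : 0 <= t -> measurable H -> measurable (X t @^-1` H).
Proof.
move=> t0 mH; apply: (usual_filtration_measurable t0).
apply: natural_filtration_usual; apply: sub_gen_smallest.
by exists t, H; rewrite t0 lexx.
Qed.

Lemma trivIset_preimage (F : nat -> set 'rV[R]_n) (Y : Omega -> 'rV[R]_n) :
  trivIset setT F -> trivIset setT (fun k => Y @^-1` F k).
Proof. by move=> tF i j _ _ [w [Fi Fj]]; apply: tF => //; exists (Y w). Qed.

Lemma path_max0_continuous w : continuous (fun t : R => X (Num.max 0 t) w).
Proof.
have /subspace_continuousP cX := @path_continuous _ _ _ _ D w.
have m0 s : (`[0, +oo[%classic : set R) (Num.max 0 s).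
  by rewrite /= in_itv/= andbT le_max lexx.
move=> t; have cXt := cX _ (m0 t).
apply: (cvg_comp (fun s : R => Num.max 0 s) (X^~ w) _ cXt) => V /= WV.
have cm : Num.max 0 s @[s --> t] --> Num.max 0 t.
  apply: (continuous_max (f := cst 0) (g := id)); first exact: cvg_cst.
  exact: cvg_id.
have nV : nbhs t [set s : R |
    (`[0, +oo[%classic : set R) (Num.max 0 s) -> V (Num.max 0 s)] := cm _ WV.
by apply: filterS nV => s /= /(_ (m0 s)).
Qed.

Lemma law_path_open_semicontinuous x (U : set 'rV[R]_n) : open U ->
  lower_semicontinuous (fun t : R => P x (X (Num.max 0 t) @^-1` U)).
Proof.
move=> oU t0 a aP; apply: contrapT => noV.
pose Y (t : R) (w : Omega) := X (Num.max 0 t) w.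
have mU t : measurable (Y t @^-1` U).
  apply: (path_measurable (H := U)); first by rewrite le_max lexx.
  exact: sub_gen_smallest.
have bad (k : nat) : exists t : R,
    `|t0 - t| < k.+1%:R^-1 /\ (P x (Y t @^-1` U) <= a%:E)%E.
  apply: contrapT => nobad; apply: noV.
  exists (ball t0 k.+1%:R^-1).
    by apply: nbhsx_ballx; rewrite invr_gt0 ltr0n.
  move=> t bt; rewrite ltNge; apply/negP => Pa; apply: nobad.
  by exists t; split.
have [u uP] := choice bad.
have ut0 : u @ \oo --> t0.
  apply/cvgrPdist_lt => e e0; near=> k.
  have [+ _] := uP k; move/lt_trans; apply.
  by near: k; exact: (near_infty_natSinv_lt (PosNum e0)).
pose B (m : nat) := \bigcap_(k in [set k | (m <= k)%N]) (Y (u k) @^-1` U).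
have mB m : measurable (B m) by apply: bigcap_measurableType.
have mUB : measurable (\bigcup_m B m) by exact: bigcupT_measurable.
have B_nd : nondecreasing_seq B.
  by move=> i j ij; apply/subsetPset => w Bw k /= jk; apply: Bw; exact: leq_trans jk.
have PBa : (P x (\bigcup_m B m) <= a%:E)%E.
  have cB := @nondecreasing_cvg_mu _ _ _ (P x) _ mB mUB B_nd.
  rewrite -(cvg_lim _ cB)//; apply: lime_le; first by apply/cvg_ex; eexists; exact: cB.
  apply: nearW => m; have [_] := uP m; apply: le_trans.
  by apply: le_measure; rewrite ?inE//; apply: bigcap_inf => /=.
have : (P x (Y t0 @^-1` U) <= P x (\bigcup_m B m))%E.
  apply: le_measure; rewrite ?inE// => w /= Uw.
  have : \forall k \near \oo, U (Y (u k) w).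
    have cY : Y (u k) w @[k --> \oo] --> Y t0 w.
      apply: (cvg_comp u (Y^~ w) ut0).
      exact: (@path_max0_continuous w t0).
    by apply: (cY U); exact: open_nbhs_nbhs.
  by move=> [m _ mU']; exists m.
by move/(lt_le_trans aP)/lt_le_trans => /(_ _ PBa); rewrite ltxx.
Unshelve. all: by end_near. Qed.

Lemma measurable_law_path x H : measurable H ->
  measurable_fun (`[0, +oo[%classic : set R)
    (fun t : R => P x (X t @^-1` H)).
Proof.
move=> mH.
have m0 (t : R) : 0 <= Num.max 0 t by rewrite le_max lexx.
have mT : measurable_fun setT
    (fun t : R => P x (X (Num.max 0 t) @^-1` H)).
  pose Q (K : set 'rV[R]_n) := measurable_fun setT
    (fun t : R => P x (X (Num.max 0 t) @^-1` K)).
  apply: (@dynkin_induction _ (borelRV R n) (@open 'rV[R]_n) Q) => //.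
  - by move=> A B; exact: openI.
  - rewrite /Q; under eq_fun do rewrite preimage_setT probability_setT.
    exact: measurable_cst.
  - move=> U oU; apply: lower_semicontinuous_measurable.
    exact: law_path_open_semicontinuous.
  - move=> K mK QK; rewrite /Q.
    rewrite (_ : (fun _ => _) =
        fun t : R => (1 - P x (X (Num.max 0 t)%R @^-1` K))%E).
      exact: emeasurable_funB.
    apply/funext => t; rewrite preimage_setC probability_setC//.
    exact: (path_measurable (H := K)).
  - move=> F mF tF QF; rewrite /Q.
    rewrite (_ : (fun _ => _) = fun t : R =>
        (\sum_(0 <= k <oo | k \in setT) P x (X (Num.max 0 t)%R @^-1` F k))%E).
      by apply: ge0_emeasurable_sum => // k _; exact: QF.
    apply/funext => t; rewrite preimage_bigcup measure_bigcup//.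
    - by move=> k _; exact: (path_measurable (H := F k)).
    - exact: trivIset_preimage.
apply: (eq_measurable_fun (fun t : R => P x (X (Num.max 0 t) @^-1` H))).
  by move=> t; rewrite inE/= in_itv/= andbT => t0; rewrite max_r.
exact: measurable_funTS.
Qed.

Variable r : R.

Definition green x (H : set (borelRV R n)) : \bar R :=
  (\int[lebesgue_measure]_(t in `[0%R, +oo[)
     ((expR (- r * t))%:E * P x (X t @^-1` H)))%E.

Let green0 x : green x set0 = 0%E.
Proof.
rewrite /green; under eq_integral do rewrite preimage_set0 measure0 mule0.
exact: integral0.
Qed.

Let green_ge0 x H : (0 <= green x H)%E.
Proof.
by apply: integral_ge0 => t _; rewrite mule_ge0// lee_fin expR_ge0.
Qed.

Let green_sigma_additive x : semi_sigma_additive (green x).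
Proof.
move=> F mF tF mUF.
rewrite (_ : green x _ = \sum_(0 <= k <oo) green x (F k))%E; last first.
  rewrite /green -integral_nneseries//.
  - apply: eq_integral => t; rewrite inE/= in_itv/= andbT => t0.
    rewrite nneseriesZl; last by move=> k _; exact: measure_ge0.
    congr *%E; rewrite preimage_bigcup measure_bigcup.
    + by apply: eq_eseriesl => k; rewrite in_setT.
    + by move=> k _; exact: path_measurable.
    + exact: trivIset_preimage.
  - move=> k; apply: emeasurable_funM; last exact: measurable_law_path.
    apply/measurable_EFinP; apply: measurableT_comp => //.
  - by move=> k t _; rewrite mule_ge0// lee_fin expR_ge0.
by apply: is_cvg_nneseries => k _ _; exact: green_ge0.
Qed.

HB.instance Definition _ x :=
  isMeasure.Build _ _ _ (green x) (green0 x) (green_ge0 x)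
    (@green_sigma_additive x).

End green_kernel.

Section optimal_stopping.
Context d (Omega : measurableType d) (R : realType) (n : nat).
Variables (D : diffusion Omega R n) (r : R) (g : 'rV[R]_n -> R).
Local Open Scope ereal_scope.

Local Notation P := (law D).
Local Notation X := (path D).

Definition hitting_time (S : set 'rV[R]_n) (w : Omega) : \bar R :=
  ereal_inf [set t%:E | t in [set t : R | (0 <= t)%R /\ S (X t w)]].

(* e^(-r tau) g(X_tau), read as a limsup as t --> +oo where tau = +oo *)
Definition discounted_reward (tau : Omega -> \bar R) (w : Omega) : \bar R :=
  if tau w == +oo
  then limf_esup (fun t : R => (expR (- r * t) * g (X t w))%:E) (pinfty_nbhs R)
  else (expR (- r * fine (tau w)) * g (X (fine (tau w)) w))%:E.

Definition expected_reward (tau : Omega -> \bar R) (x : 'rV[R]_n) : \bar R :=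
  \int[P x]_w discounted_reward tau w.

Definition value_function (x : 'rV[R]_n) : \bar R :=
  ereal_sup [set expected_reward tau x | tau in stopping_time P X].

Definition optimal_stopping_time (tau : Omega -> \bar R) : Prop :=
  stopping_time P X tau /\ forall x, expected_reward tau x = value_function x.

Definition stopping_set : set 'rV[R]_n :=
  [set x | value_function x = (g x)%:E].

(* lambda({t <= tau : X_t \in A}) *)
Definition occupation_time (tau : Omega -> \bar R) (A : set 'rV[R]_n)
    (w : Omega) : \bar R :=
  lebesgue_measure [set t : R | [/\ (0 <= t)%R, t%:E <= tau w & A (X t w)]].

End optimal_stopping.

(* Main.v *)
(** Write [V_U x] for the integral of [f] over [U] against [green x], so that
    [value_function = V_S].  Let [U] satisfy the boundary equation.  The strong
    Markov property at the hitting time of [~` U] carries the equation from the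
    boundary to [U], so [V_U = g] on [U]; at the hitting time [tau] of [U] it
    then gives [V_U x = E_x (e^(-r tau) g (X_tau); tau < +oo)], whence
    [V_U <= V_S] everywhere.
    For [x] in [S] and [U] both functions equal [g x]; comparing them up to the
    exit time from [S] shows that the path spends no time in [S `\` U] before
    it, as [f > 0] there, and (b)(i) yields [S `<=` U].  Up to the hitting
    time of [S], where [V_U = g = V_S], the path contributes to [V_U - V_S] the
    discounted [f]-time spent in [U], which therefore vanishes; (b)(ii)
    yields [U `<=` S]. *)

Require Import Defs.
From HB Require Import structures.
From mathcomp Require Import all_boot all_order all_algebra.
From mathcomp Require Import all_classical all_reals all_analysis.
From mathcomp Require Import measurable_realfun lra.

Set Implicit Arguments.
Unset Strict Implicit.
Unset Printing Implicit Defensive.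

Import Order.TTheory GRing.Theory Num.Theory.
Import numFieldNormedType.Exports.

Local Open Scope classical_set_scope.
Local Open Scope ring_scope.

(** * Measurability of paths and hitting times *)

(* For open [O] these closed sets exhaust [O]; they reduce events about
   continuous paths to countably many times. *)
Definition deep_part {R : realType} {V : pseudoMetricNormedZmodType R}
    (O : set V) (m : nat) : set V :=
  [set y | ball y m.+1%:R^-1 `<=` O].

Section deep_part.
Context {R : realType} {V : pseudoMetricNormedZmodType R}.
Implicit Types (O : set V) (m : nat).

Lemma deep_part_sub O m : deep_part O m `<=` O.
Proof. by move=> y; apply; apply: ballxx; rewrite invr_gt0. Qed.

Lemma closed_deep_part O m : closed (deep_part O m).
Proof.
move=> y cy z yz.
have : nbhs y (ball z m.+1%:R^-1).
  by apply: open_nbhs_nbhs; split; [exact: ball_open|exact: ball_sym].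
by move=> /cy [u [Du /ball_sym zu]]; exact: Du.
Qed.

(** Half the radius of a ball around [x] inside [O] pays for the distance from [x] to [y], the other
    half for the ball around [y]. Varying [y] and [m] jointly is what the compactness argument for
    closed sets requires. *)
Lemma near_deep_part O x : open O -> O x ->
  \forall y \near x & m \near \oo, deep_part O m y.
Proof.
move=> oO Ox.
have /nbhs_ballP[e /= e0 xeO] : nbhs x O by exact: open_nbhs_nbhs.
have e20 : 0 < e / 2 by rewrite divr_gt0.
exists (ball x (e / 2), [set m : nat | m.+1%:R^-1 < e / 2]) => /=.
  split; first exact: nbhsx_ballx.
  exact: (near_infty_natSinv_lt (PosNum e20)).
move=> [y m] /= [xy me] z yz; apply: xeO.
apply: (@ball_split _ _ y) => //; apply: le_ball yz; exact: ltW.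
Qed.

End deep_part.

Lemma bigcap_measurable_rat d (T : measurableType d) (P : set rat)
    (F : rat -> set T) :
  (forall q, P q -> measurable (F q)) -> measurable (\bigcap_(q in P) F q).
Proof.
move=> mF; rewrite -[X in measurable X]setCK setC_bigcap bigcup_mkcond.
apply: measurableC; apply: bigcupT_measurable_rat => q.
by case: ifPn => // /set_mem /mF; exact: measurableC.
Qed.

(** Rational times in [A] accumulate at [t], so by continuity [y t] is a limit point of values in
    the closed set [C]. *)
Lemma closed_rat_dense (R : realType) (V : topologicalType) (y : R -> V)
    (C : set V) (A : set R) (t : R) :
  continuous y -> closed C -> open A -> A t ->
  (forall q : rat, A (ratr q) -> C (y (ratr q))) -> C (y t).
Proof.
move=> cy cC oA At AC; apply: cC => B ytB.
have yB : nbhs t (y @^-1` B) by exact: cy ytB.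
have : nbhs t (A `&` y @^-1` B) by apply: filterI => //; exact: open_nbhs_nbhs.
rewrite nbhsE => -[V' [oV Vt] VAB].
have [x [Vx [q _ qx]]] := @dense_rat R V' (ex_intro _ t Vt) oV.
by have [Ax Bx] := VAB _ Vx; exists (y x); rewrite -qx in Ax Bx *; split => //;
  exact: AC.
Qed.

Section continuous_process.
Context d (T : measurableType d) (R : realType) (n : nat).
Variable Y : R -> T -> 'rV[R]_n.
Hypothesis cY : forall w, continuous (Y^~ w).
Hypothesis mY : forall t, measurable_fun setT (Y t : T -> borelRV R n).

Lemma measurable_continuous_process :
  measurable_fun setT (fun p : T * R => Y p.2 p.1 : borelRV R n).
Proof.
apply: (@measurability _ _ _ (borelRV R n) setT _ (@open _) erefl) => //.
move=> _ [G oG <-]; rewrite setTI.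
(* [Y t w] lies in [G] iff, around [t], the path of [w] stays in a fixed deep
   part of [G] at rational times. *)
have -> : (fun p : T * R => Y p.2 p.1) @^-1` G =
  \bigcup_(p : rat) \bigcup_(m : nat)
    ((\bigcap_(q in [set q : rat | ball (ratr p : R) m.+1%:R^-1 (ratr q)])
       (Y (ratr q) @^-1` deep_part G m)) `*` ball (ratr p : R) m.+1%:R^-1).
  apply/seteqP; split => [[w t] /= Gt|[w t] [p _ [m _ [/= wp pt]]]].
    have [[A B] [nA [N _ NB]] ABO] := near_deep_part oG Gt.
    have /nbhs_ballP[e /= e0 eA] : nbhs t ((Y^~ w) @^-1` A) by exact: cY nA.
    have e20 : 0 < e / 2 by rewrite divr_gt0.
    have [M _ MP] := near_infty_natSinv_lt (PosNum e20).
    (* A single index controls both the depth inside [G] and the radius of the time window. *)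
    pose m := maxn N M.
    have me : m.+1%:R^-1 < e / 2 by apply: MP; exact: leq_maxr.
    have m0 : 0 < m.+1%:R^-1 :> R by rewrite invr_gt0.
    have [y [ty [p _ py]]] := @dense_rat R (ball t m.+1%:R^-1)
      (ex_intro _ t (ballxx _ m0)) (ball_open _ _).
    have tp : ball t m.+1%:R^-1 (ratr p) by rewrite py.
    exists p => //; exists m => //; split => /=; last exact: ball_sym.
    move=> q /= pq; apply: (ABO (_, m)) => /=; split; last by apply: NB;
      exact: leq_maxl.
    suff : ball t e (ratr q) by exact: eA.
    apply: (@ball_split R R (ratr p)).
      by apply: le_ball tp; exact: ltW.
    by apply: le_ball pq; exact: ltW.
  apply: (@deep_part_sub _ _ _ m).
  apply: (@closed_rat_dense _ _ (Y^~ w) _ (ball (ratr p : R) m.+1%:R^-1)) => //.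
    exact: closed_deep_part.
  exact: ball_open.
apply: bigcupT_measurable_rat => p; apply: bigcupT_measurable => m.
apply: measurableX; last exact: measurable_ball.
apply: bigcap_measurable_rat => q _; rewrite -[X in measurable X]setTI.
apply: mY => //.
rewrite -[X in measurable X]setCK; apply: measurableC; apply: sub_gen_smallest.
by apply: closed_openC; exact: closed_deep_part.
Qed.
End continuous_process.

(** * Hitting times of open and closed sets *)

Section hitting_times.
Context d (Omega : measurableType d) (R : realType) (n : nat).
Variable D : diffusion Omega R n.
Implicit Types (S C : set 'rV[R]_n) (w : Omega) (t : R).
Local Notation P := (law D).
Local Notation X := (Defs.path D).

Lemma cvg_path w t : 0 <= t -> X (Num.max 0 s) w @[s --> t] --> X t w.
Proof.
by move=> t0; have := @path_max0_continuous _ _ _ _ D w t;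
  rewrite /continuous_at max_r.
Qed.

Lemma hitting_time_ge0 S w : (0 <= hitting_time D S w)%E.
Proof. by apply: le_ereal_inf_tmp => _ [t [t0 _] <-]; rewrite lee_fin. Qed.

Lemma hitting_time_le S w t : 0 <= t -> S (X t w) ->
  (hitting_time D S w <= t%:E)%E.
Proof. by move=> t0 St; apply: ereal_inf_lbound; exists t. Qed.

Lemma hitting_time_lt S w t : (hitting_time D S w < t%:E)%E ->
  exists s, [/\ 0 <= s, s < t & S (X s w)].
Proof.
by move=> /ereal_inf_lt[_ [s [s0 Ss] <-]]; rewrite lte_fin => st; exists s.
Qed.

Lemma hitting_time_fin S w : (hitting_time D S w < +oo)%E ->
  hitting_time D S w = (fine (hitting_time D S w))%:E.
Proof. by move=> h; rewrite fineK// ge0_fin_numE// hitting_time_ge0. Qed.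

(** Visits to [S] occur at times arbitrarily close to the infimum from the right; path continuity
    does the rest. *)
Lemma hitting_time_closure S w : (hitting_time D S w < +oo)%E ->
  closure S (X (fine (hitting_time D S w)) w).
Proof.
move=> hfin; set h := fine _.
have hE : hitting_time D S w = h%:E by exact: hitting_time_fin.
have h0 : 0 <= h by rewrite fine_ge0// hitting_time_ge0.
move=> B nB; have /nbhs_ballP[e /= e0 eB] := cvg_path h0 nB.
have : (hitting_time D S w < (h + e)%:E)%E by rewrite hE lte_fin ltrDl.
move=> /hitting_time_lt[s [s0 sh Ss]]; exists (X s w); split => //.
have hs : h <= s by rewrite -lee_fin -hE; exact: hitting_time_le.
have : ball h e s by rewrite /ball/= ler0_norm ?subr_le0// opprB ltrBlDl.
by move=> /eB /=; rewrite max_r.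
Qed.

Lemma path_before_hitting S w t : 0 <= t -> (t%:E < hitting_time D S w)%E ->
  ~ S (X t w).
Proof. by move=> t0 th /(hitting_time_le t0); rewrite leNgt th. Qed.

(** Times just before the exit show that the exit position is in the closed set [C]; visits to the
    complement just after show that it is not interior. An exit at time [0] is covered by the
    starting position. *)
Lemma path_hitting_boundary C w : closed C -> C (X 0 w) ->
  (hitting_time D (~` C) w < +oo)%E ->
  boundary C (X (fine (hitting_time D (~` C) w)) w).
Proof.
move=> cC C0 hfin; set h := fine _.
have hE : hitting_time D (~` C) w = h%:E by exact: hitting_time_fin.
have h0 : 0 <= h by rewrite fine_ge0// hitting_time_ge0.
split; last first.
  have := hitting_time_closure hfin; rewrite -/h.
  by rewrite closure_setC.
apply: subset_closure.
have [<-//|h_neq0] := eqVneq 0 h.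
have {h_neq0}h_gt0 : 0 < h by rewrite lt_neqAle h_neq0.
apply: cC => B nB; have /nbhs_ballP[e /= e0 eB] := cvg_path h0 nB.
(* A nonnegative time strictly before [h] and at distance less than [e] from it. *)
pose s := Num.max (h / 2) (h - e / 2).
have s0 : 0 <= s by rewrite le_max divr_ge0// ltW.
have sh : s < h by rewrite gt_max ltrBlDl ltrDr divr_gt0// andbT ltr_pdivrMr//
  ltr_pMr// ltr1n.
exists (X s w); split; last first.
  have : ball h e s.
    rewrite /ball/= ger0_norm ?subr_ge0 ?(ltW sh)// ltrBlDl -ltrBlDr lt_max.
    by apply/orP; right; rewrite ltrD2l ltrN2 ltr_pdivrMr// ltr_pMr// ltr1n.
  by move=> /eB /=; rewrite max_r.
apply: contrapT; apply: (@path_before_hitting (~` C)) => //.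
by rewrite hE lte_fin.
Qed.

(** Right-continuity is built into the usual filtration: at [t] only the later times [s] are tested,
    and the exceptional null set can be taken empty. *)
Lemma natural_stopping_time (tau : Omega -> \bar R) :
  (forall w, 0 <= tau w)%E ->
  (forall t s, 0 <= t -> t < s ->
    natural_filtration X s [set w | (tau w <= t%:E)%E]) ->
  stopping_time P X tau.
Proof.
move=> tau0 mtau; split => // t t0 mu s ts.
exists [set w | (tau w <= t%:E)%E], set0; split.
- exact: mtau.
- exact: sigma_algebra0.
- by rewrite (eq_integral (cst 0%E)) ?integral0// => y _; rewrite measure0.
- by rewrite setYK.
Qed.

Lemma natural_filtration_path s t (H : set (borelRV R n)) :
  0 <= s <= t -> measurable H -> natural_filtration X t (X s @^-1` H).
Proof. by move=> st mH; apply: sub_gen_smallest; exists s, H. Qed.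

Lemma stopping_time_hitting_open S : open S ->
  stopping_time P X (hitting_time D S).
Proof.
move=> oS; apply: natural_stopping_time; first exact: hitting_time_ge0.
move=> t s t0 ts.
(* Openness of [S] moves a visit to a nearby rational time. The restriction on [k] keeps every
   inspected time below [s], and negative rationals are clamped to [0]. *)
have -> : [set w | (hitting_time D S w <= t%:E)%E] =
    \bigcap_(k in [set k : nat | k.+1%:R^-1 < s - t])
    \bigcup_(q in [set q : rat | ratr q < t + k.+1%:R^-1])
      (X (Num.max 0 (ratr q)) @^-1` S).
  apply/seteqP; split => [w /= ht k _|w /= hw].
    have : (hitting_time D S w < (t + k.+1%:R^-1)%:E)%E.
      by apply: le_lt_trans ht _; rewrite lte_fin ltrDl invr_gt0.
    move=> /hitting_time_lt[u [u0 ut Su]].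
    have : nbhs u ([set v | v < t + k.+1%:R^-1] `&`
                   (fun v => X (Num.max 0 v) w) @^-1` S).
      apply: filterI; first by apply: open_nbhs_nbhs; split => //;
        exact: open_lt.
      by apply: (cvg_path u0); exact: open_nbhs_nbhs.
    rewrite nbhsE => -[V [oV Vu] VI].
    have [x [Vx [q _ qx]]] := @dense_rat R V (ex_intro _ u Vu) oV.
    by have [? ?] := VI _ Vx; exists q; rewrite /= qx.
  apply/lee_addgt0Pr => e e0.
  (* Below [s - t] makes [k] admissible, below [e] gives the required bound. *)
  have m0 : 0 < Num.min e (s - t) by rewrite lt_min e0 subr_gt0.
  have [k _ /(_ k (leqnn k)) /=] := near_infty_natSinv_lt (PosNum m0).
  rewrite lt_min => /andP[ke kst].
  have [q /= qt Sq] := hw k kst.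
  apply: (@le_trans _ _ (Num.max 0 (ratr q))%:E).
    by apply: hitting_time_le => //; rewrite le_max lexx.
  rewrite -EFinD lee_fin ge_max addr_ge0// ?(ltW e0)//=.
  by rewrite (le_trans (ltW qt))// lerD2l ltW.
pose T := g_sigma_algebraType [set A | exists (u : R) (H : set (borelRV R n)),
         [/\ 0 <= u <= s, measurable H & A = X u @^-1` H]].
apply: (@bigcap_measurableType _ T) => k /= ks.
rewrite bigcup_mkcond; apply: (@bigcupT_measurable_rat _ T) => q.
case: ifPn => // /set_mem /= qt.
apply: (natural_filtration_path (H := S)); last exact: sub_gen_smallest.
rewrite le_max lexx ge_max /= (le_trans t0 (ltW ts))/=.
by rewrite (le_trans (ltW qt))// -lerBrDl ltW.
Qed.

(** A path avoiding [C] on the compact interval [[0, t]] stays in one deep part of the complement.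
    Deep parts are closed, so rational times detect this. *)
Lemma stopping_time_hitting_closed C : closed C ->
  stopping_time P X (hitting_time D C).
Proof.
move=> cC; apply: natural_stopping_time; first exact: hitting_time_ge0.
move=> t s t0 ts.
(* Freezing the path outside [[0, t]] lets the intersection below run over all rationals. *)
pose Y (u : R) w := X (Num.max 0 (Num.min t u)) w.
have cY w : continuous (Y^~ w).
  move=> u; apply: (@continuous_comp _ _ _ (fun u : R => Num.min t u) (fun u =>
    X (Num.max 0 u) w)).
    apply: (@continuous_min _ R (cst t) id); first exact: cvg_cst.
    exact: cvg_id.
  exact: path_max0_continuous.
have oC : open (~` C) by exact: closed_openC.
have -> : [set w | (hitting_time D C w <= t%:E)%E] = ~` \bigcup_(m : nat)
    \bigcap_(q : rat) (Y (ratr q) @^-1` deep_part (~` C) m).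
  rewrite -[LHS]setCK; congr (~` _); apply/seteqP;
    split => [w /= /negP|w [m _ wm] /=].
    rewrite -ltNge => th.
    (* Around each time the path is deep in the complement for all large [m]; compactness yields one
       [m] for the whole interval. *)
    have /compact_near_coveringP := @segment_compact R 0 t.
    move=> /(_ nat \oo (fun m u => deep_part (~` C) m (Y u w)) _)[].
      move=> u /= /[!in_itv]/= /andP[u0 ut].
      have nCu : (~` C) (Y u w).
        rewrite /Y min_r// max_r//; apply: path_before_hitting => //.
        by apply: le_lt_trans th; rewrite lee_fin.
      have [[A B] [nA nB] AB] := near_deep_part oC nCu.
      exists ((Y^~ w) @^-1` A, B); first by split => //; exact: cY nA.
      by move=> [u' m] /= [Au' Bm]; apply: (AB (_, _)).
    move=> m _ /(_ m (leqnn m)) mP; exists m => // q _ /=.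
    have qt : 0 <= Num.max 0 (Num.min t (ratr q : R)) <= t.
      by rewrite le_max lexx ge_max t0/= ge_min lexx.
    have /andP[q0 qt'] := qt.
    have : `[0, t]%classic (Num.max 0 (Num.min t (ratr q))) by rewrite /=
      in_itv.
    by move=> /mP; rewrite /Y (min_r qt') (max_r q0).
  apply/negP; rewrite -ltNge ltNge; apply/negP => ht.
  have hfin : (hitting_time D C w < +oo)%E by apply: le_lt_trans ht _;
    rewrite ltry.
  have := hitting_time_closure hfin; set h := fine _ => Ch.
  have h0 : 0 <= h by rewrite fine_ge0// hitting_time_ge0.
  have hlt : h <= t by rewrite -lee_fin -hitting_time_fin.
  have : deep_part (~` C) m (Y h w).
    apply: (closed_rat_dense (cY w) (@closed_deep_part _ _ (~` C) m) openT I).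
    by move=> q _; exact: wm.
  rewrite /Y min_r// max_r// => /deep_part_sub; apply; exact: cC.
pose T := g_sigma_algebraType [set A | exists (u : R) (H : set (borelRV R n)),
         [/\ 0 <= u <= s, measurable H & A = X u @^-1` H]].
apply: (@measurableC _ T); apply: (@bigcupT_measurable _ T) => m.
apply: (@bigcap_measurable_rat _ T) => q _.
apply: (natural_filtration_path (H := deep_part (~` C) m)).
  by rewrite le_max lexx ge_max (le_trans t0 (ltW ts))/= ge_min (ltW ts).
rewrite -[X in measurable X]setCK; apply: measurableC; apply: sub_gen_smallest.
by apply: closed_openC; exact: closed_deep_part.
Qed.

End hitting_times.

(** * Mixtures of measures *)

Section integral_mixture.
Local Open Scope ereal_scope.
Context d d' (W : measurableType d) (Y : measurableType d') (R : realType).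
Variables (l : {measure set W -> \bar R}) (A : set W) (mA : measurable A).
Variables (k : W -> {measure set Y -> \bar R}).
Hypothesis mk : forall H, measurable H -> measurable_fun A (k^~ H).

Import HBNNSimple.

Lemma integral_mixture_nnsfun (h : {nnsfun Y >-> R}) :
  \int[l]_(w in A) \int[k w]_y (h y)%:E =
  \sum_(c \in range h) (c%:E * \int[l]_(w in A) k w (h @^-1` [set c])).
Proof.
under eq_integral do rewrite integralT_nnsfun sintegralE.
rewrite ge0_integral_fsum//; last 2 first.
- by move=> c; apply: measurable_funeM; exact: mk.
- move=> c w _; have [c0|c0] := leP 0%R c; first by rewrite mule_ge0.
  by rewrite preimage_nnfun0// measure0 mule0.
apply: eq_fsbigr => c /set_mem [y _ <-].
by rewrite ge0_integralZl//; [exact: mk|rewrite lee_fin].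
Qed.

(** Monotone convergence is applied twice: under each [k w], then under [l]. *)
Lemma integral_mixture_cvg (F : Y -> \bar R) (mF : measurable_fun setT F) :
  (forall y, 0 <= F y) ->
  \int[l]_(w in A) \int[k w]_y F y =
  limn (fun i => \int[l]_(w in A) \int[k w]_y (nnsfun_approx measurableT mF i
    y)%:E).
Proof.
move=> F0; pose F_ := nnsfun_approx measurableT mF.
rewrite -monotone_convergence//.
- apply: eq_integral => w _; rewrite -monotone_convergence//.
  + apply: eq_integral => y _; apply/esym/cvg_lim => //.
    exact: cvg_nnsfun_approx.
  + by move=> i; exact/measurable_EFinP.
  + by move=> i y _; rewrite lee_fin.
  + by move=> y _ i j ij; rewrite lee_fin; exact/lefP/nd_nnsfun_approx.
- move=> i; under eq_fun do rewrite integralT_nnsfun sintegralE.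
  apply: emeasurable_fsum => // c.
  by apply: measurable_funeM; exact: mk.
- by move=> i w _; apply: integral_ge0 => y _; rewrite lee_fin.
- move=> w _ i j ij; apply: ge0_le_integral => //.
  + by move=> y _; rewrite lee_fin.
  + exact/measurable_EFinP.
  + exact/measurable_EFinP.
  + by move=> y _; rewrite lee_fin; exact/lefP/nd_nnsfun_approx.
Qed.

End integral_mixture.

Section eq_integral_mixture.
Import HBNNSimple.

(** This promotes identities between measures of sets, such as the Markov property, to nonnegative
    functions: both sides are limits of the same sums over simple functions. *)
Lemma eq_integral_mixture d1 d2 d' (W1 : measurableType d1)
    (W2 : measurableType d2) (Y : measurableType d') (R : realType)
    (l1 : {measure set W1 -> \bar R}) (l2 : {measure set W2 -> \bar R})
    (A1 : set W1) (A2 : set W2)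
    (k1 : W1 -> {measure set Y -> \bar R}) (k2 : W2 -> {measure set Y ->
      \bar R})
    (F : Y -> \bar R) :
  measurable A1 -> measurable A2 ->
  (forall H, measurable H -> measurable_fun A1 (k1^~ H)) ->
  (forall H, measurable H -> measurable_fun A2 (k2^~ H)) ->
  (forall H, measurable H ->
    \int[l1]_(w in A1) k1 w H = \int[l2]_(w in A2) k2 w H)%E ->
  measurable_fun setT F -> (forall y, (0 <= F y)%E) ->
  (\int[l1]_(w in A1) \int[k1 w]_y F y = \int[l2]_(w in A2) \int[k2 w]_y F y)%E.
Proof.
move=> mA1 mA2 mk1 mk2 k12 mF F0.
rewrite !(integral_mixture_cvg _ _ _ mF)//; congr (limn _); apply/funext => i.
rewrite !integral_mixture_nnsfun//; apply: eq_fsbigr => c _.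
by rewrite k12.
Qed.

End eq_integral_mixture.

Lemma ge0_integral_mixture d1 d' (W : measurableType d1)
    (Y : measurableType d') (R : realType)
    (m : {measure set Y -> \bar R}) (l : {measure set W -> \bar R})
    (A : set W) (k : W -> {measure set Y -> \bar R}) (F : Y -> \bar R) :
  measurable A ->
  (forall H, measurable H -> measurable_fun A (k^~ H)) ->
  (forall H, measurable H -> m H = \int[l]_(w in A) k w H)%E ->
  measurable_fun setT F -> (forall y, (0 <= F y)%E) ->
  (\int[m]_y F y = \int[l]_(w in A) \int[k w]_y F y)%E.
Proof.
move=> mA mk mE mF F0.
(* The measure [m] is a mixture of itself over the one-point space. *)
rewrite -(@eq_integral_mixture _ _ _ unit _ _ _ (\d_tt) _ setT _ (fun=> m))//.
- by rewrite integral_cst//= diracE in_setT mule1.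
- by move=> H mH; rewrite integral_cst//= diracE in_setT mule1 mE.
Qed.

(** * Exponential discounting *)

Section discount.
Local Open Scope ereal_scope.
Context (R : realType).
Variable r : R.
Hypothesis r_gt0 : (0 < r)%R.
Local Notation mu := (@lebesgue_measure R).

(** Extension by zero turns integrals over the half line into integrals over [R], which suits
    translations and Tonelli's theorem. *)
Definition discount (t : R) : R := if (0 <= t)%R then expR (- r * t) else 0%R.

(* [e^(-r x)], with value [0] at [+oo] (and at negative arguments). *)
Definition ediscount (x : \bar R) : \bar R :=
  if x is t%:E then (discount t)%:E else 0.

Lemma discount_ge0 t : (0 <= discount t)%R.
Proof. by rewrite /discount; case: ifP => // _; exact: expR_ge0. Qed.

Lemma ediscount_ge0 x : 0 <= ediscount x.
Proof. by case: x => //= t; rewrite lee_fin discount_ge0. Qed.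

(** The exponential density supplies both measurability and the total mass [1/r]. *)
Lemma discountE : discount = (fun t => r^-1 * exponential_pdf r t)%R.
Proof.
apply/funext => t; rewrite /discount; case: ifPn => t0.
  by rewrite exponential_pdfE// mulKf// gt_eqF.
by rewrite lt0_exponential_pdf ?mulr0// ltNge.
Qed.

Lemma measurable_discount : measurable_fun setT discount.
Proof.
by rewrite discountE; apply: measurable_funM => //;
  exact: measurable_exponential_pdf.
Qed.

Lemma measurable_ediscount : measurable_fun setT ediscount.
Proof.
have -> : ediscount = (fun x =>
  if x \is a fin_num then (discount (fine x))%:E else 0).
  by apply/funext; case.
have mid : measurable_fun [set: \bar R] (fun x : \bar R => x).
  exact: measurable_id.
apply: measurable_fun_ifT => //.
  apply: (measurable_fun_bool true).
  by have := emeasurable_fin_num measurableT mid; rewrite setTI.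
by apply/measurable_EFinP/measurableT_comp; first exact: measurable_discount.
Qed.

Lemma integral_discount : \int[mu]_t (discount t)%:E = r^-1%:E.
Proof.
rewrite discountE; under eq_integral do rewrite EFinM.
rewrite ge0_integralZl//.
- by rewrite integral_exponential_pdf// mule1.
- by apply/measurable_EFinP; exact: measurable_exponential_pdf.
- by move=> t _; rewrite lee_fin exponential_pdf_ge0// ltW.
- by rewrite lee_fin invr_ge0 ltW.
Qed.

(** Both measures agree on half-open intervals, and Lebesgue measure is determined there. *)
Lemma lebesgue_measure_translate (a : R) (A : set R) : measurable A ->
  mu A = pushforward mu (+%R a : measurableTypeR R -> measurableTypeR R) A.
Proof.
have ma : measurable_fun setT (+%R a : measurableTypeR R -> measurableTypeR R).
  exact: measurable_funD.
pose ma' := isMeasurableFun.Build _ _ _ _ _ ma.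
pose am : {mfun _ >-> _} :=
  HB.pack (+%R a : measurableTypeR R -> measurableTypeR R) ma'.
apply: (@lebesgue_measure_unique _ (pushforward mu am)) => _ [[x y]] _ <-.
rewrite -[RHS]/(mu (+%R a @^-1` `]x, y])).
rewrite (_ : _ @^-1` _ = `](x - a)%R, (y - a)%R]%classic); last first.
  by apply/seteqP; split => s /=; rewrite !in_itv/= ltrBlDl lerBrDl.
rewrite !lebesgue_measure_itv/= !lte_fin ltrD2r; case: ifP => // _.
by rewrite -!EFinB opprB addrA subrK.
Qed.

Lemma ge0_integral_translate (a : R) (phi : R -> \bar R) :
  measurable_fun setT phi -> (forall t, 0 <= phi t) ->
  \int[mu]_t phi t = \int[mu]_t phi (a + t)%R.
Proof.
move=> mphi phi0.
have ma : measurable_fun setT (+%R a : measurableTypeR R -> measurableTypeR R).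
  exact: measurable_funD.
transitivity
  (\int[pushforward mu (+%R a : measurableTypeR R -> measurableTypeR R)]_t
     phi t).
  apply: eq_measure_integral => A mA _; exact: lebesgue_measure_translate.
by rewrite ge0_integral_pushforward.
Qed.

Lemma integral_discount_shift (a : R) (phi : R -> \bar R) : (0 <= a)%R ->
  measurable_fun setT phi -> (forall t, 0 <= phi t) ->
  \int[mu]_(t in `[a, +oo[) ((discount t)%:E * phi t) =
  (discount a)%:E * \int[mu]_t ((discount t)%:E * phi (a + t)%R).
Proof.
move=> a0 mphi phi0.
have mdphi : measurable_fun setT (fun t => (discount t)%:E * phi t).
  by apply: emeasurable_funM => //; apply/measurable_EFinP;
    exact: measurable_discount.
rewrite [LHS]integral_mkcond [LHS](ge0_integral_translate a); last 2 first.
- by apply: (iffLR (measurable_restrictT _ _)) => //; exact: measurable_funTS.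
- by move=> t; rewrite patchE; case: ifP => // _;
  rewrite mule_ge0// lee_fin discount_ge0.
rewrite -ge0_integralZl//.
- apply: eq_integral => t _; rewrite patchE mem_setE in_itv/= andbT lerDl.
  rewrite muleA -EFinM /discount a0; case: ifPn => t0;
    last by rewrite mulr0 mul0e.
  by rewrite addr_ge0// mulrDr expRD.
- apply: emeasurable_funM.
    by apply/measurable_EFinP; exact: measurable_discount.
  by apply: measurableT_comp => //; exact: measurable_funD.
- by move=> t _; rewrite mule_ge0// lee_fin discount_ge0.
- by rewrite lee_fin discount_ge0.
Qed.

Lemma integral_discount_tail (x : \bar R) : 0 <= x ->
  \int[mu]_(t in [set t | x <= t%:E]) (discount t)%:E = ediscount x * r^-1%:E.
Proof.
case: x => [a|_|//] /=; last first.
  by rewrite mul0e integral0_eq// => t; rewrite /= leye_eq.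
rewrite lee_fin => a0; have := @integral_discount_shift a (cst 1) a0.
under eq_integral do rewrite mule1.
under [X in _ = _ * X]eq_integral do rewrite mule1.
rewrite integral_discount => <- //; congr integral.
by apply/seteqP; split => t /=; rewrite in_itv/= andbT lee_fin.
Qed.

(* Since [e^(-r tau)] is [r] times the integral of [e^(-r u)] over [u >= tau],
   it is enough to compare integrals over the events [tau <= u]. *)
Lemma integral_ediscount_eq d (T : measurableType d) (P : probability T R)
    (tau : T -> \bar R) (k1 k2 : T -> \bar R) :
  measurable_fun setT tau -> (forall w, 0 <= tau w) ->
  measurable_fun setT k1 -> (forall w, 0 <= k1 w) ->
  measurable_fun setT k2 -> (forall w, 0 <= k2 w) ->
  (forall u, (0 <= u)%R -> \int[P]_(w in [set w | tau w <= u%:E]) k1 w =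
                      \int[P]_(w in [set w | tau w <= u%:E]) k2 w) ->
  \int[P]_w (ediscount (tau w) * k1 w) = \int[P]_w (ediscount (tau w) * k2 w).
Proof.
move=> mtau tau0 mk1 k10 mk2 k20 k12.
(* Tonelli's theorem on the region [tau w <= u]: integrating first in [u] gives the tail of the
   discount, integrating first in [w] gives the events at fixed [u]. *)
have layer (k : T -> \bar R) : measurable_fun setT k -> (forall w, 0 <= k w) ->
    \int[P]_w (ediscount (tau w) * k w) * r^-1%:E =
    \int[mu]_u ((discount u)%:E * \int[P]_(w in [set w | tau w <= u%:E]) k w).
  move=> mk k0.
  pose h (p : T * measurableTypeR R) :=
    (discount p.2)%:E * (k p.1 *
      (\1_[set p : T * measurableTypeR R | (tau p.1 <= (p.2 : R)%:E)%E] p)%:E).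
  have mh : measurable_fun setT h.
    apply: emeasurable_funM.
      by apply/measurable_EFinP; apply: measurableT_comp => //;
        exact: measurable_discount.
    apply: emeasurable_funM; first exact: measurableT_comp.
    apply/measurable_EFinP; apply: measurable_indic.
    rewrite -[X in measurable X]setTI; apply: measurable_lee => //.
      exact: measurableT_comp.
    by apply/measurable_EFinP.
  have h0 p : 0 <= h p by rewrite !mule_ge0// lee_fin ?discount_ge0.
  have mdk : measurable_fun setT (fun w => ediscount (tau w) * k w).
    by apply: emeasurable_funM => //; apply: measurableT_comp => //;
      exact: measurable_ediscount.
  transitivity (\int[P]_w \int[mu]_u h (w, u)).
    rewrite -ge0_integralZr//; last 2 first.
    - by move=> w _; rewrite mule_ge0// ediscount_ge0.
    - by rewrite lee_fin invr_ge0 ltW.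
    apply: eq_integral => w _; rewrite -muleA (muleC (k w)) muleA.
    rewrite -integral_discount_tail// muleC integral_mkcond -ge0_integralZl//.
    - apply: eq_integral => u _; rewrite /h/= patchE indicE.
      rewrite [in RHS](_ : (w, u) \in _ = (u \in [set t | tau w <= t%:E]));
        last first.
        by apply/idP/idP => /set_mem ?; apply/mem_set.
      by case: ifPn => _; rewrite ?mule0 ?mul1e ?mule1// muleC.
    - apply: (iffLR (measurable_restrictT _ _)).
        by rewrite -[X in measurable X]setTI; apply: measurable_lee => //;
          exact/measurable_EFinP.
      by apply: measurable_funTS; apply/measurable_EFinP;
        exact: measurable_discount.
    - by move=> u _; rewrite patchE; case: ifP => // _;
      rewrite lee_fin discount_ge0.
  rewrite (@fubini_tonelli _ _ _ _ _ P mu h)//.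
  apply: eq_integral => u _; rewrite [in RHS]integral_mkcond -ge0_integralZl//.
  - apply: eq_integral => w _; rewrite /h/= patchE indicE.
    rewrite [in LHS](_ : (w, u) \in _ = (w \in [set w | tau w <= u%:E]));
      last first.
      by apply/idP/idP => /set_mem ?; apply/mem_set.
    by case: ifPn => _; rewrite ?mule0 ?mule1.
  - apply: (iffLR (measurable_restrictT _ _)); last exact: measurable_funTS.
    by rewrite -[X in measurable X]setTI; apply: measurable_lee.
  - by move=> w _; rewrite patchE; case: ifP.
  - by rewrite lee_fin discount_ge0.
have rV : r^-1%:E * r%:E = 1 by rewrite -EFinM mulVf// gt_eqF.
rewrite -[LHS]mule1 -[RHS]mule1 -rV !muleA.
rewrite (layer k1 mk1 k10) (layer k2 mk2 k20); congr (_ * _).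
apply: eq_integral => u _.
have [u0|u0] := leP 0%R u; first by rewrite k12.
by rewrite /discount leNgt u0/= !mul0e.
Qed.

End discount.

(** * The Green kernel as an integral along paths *)

Section natural_space.
Local Open Scope ereal_scope.
Context d (Omega : measurableType d) (R : realType) (n : nat).
Variable D : diffusion Omega R n.
Local Notation P := (law D).

(* Clamping the time at [0] makes the path continuous on all of [R]. *)
Definition tpath (t : R) (w : Omega) : borelRV R n :=
  Defs.path D (Num.max 0%R t) w.

(* [law_measurable] only concerns events of the natural sigma-algebra, so the
   laws form a measurable kernel only on this space. *)
Definition natural_space := g_sigma_algebraType
  [set A | exists (s : R) (H : set (borelRV R n)),
         [/\ (0 <= s)%R, measurable H & A = Defs.path D s @^-1` H]].

Definition to_natural (w : Omega) : natural_space := w.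

Lemma max0_ge0 (t : R) : (0 <= Num.max 0 t)%R.
Proof. by rewrite le_max lexx. Qed.

Lemma measurable_tpath t : measurable_fun setT (tpath t).
Proof.
move=> _ H mH; rewrite setTI; apply: (@path_measurable _ _ _ _ D _ H) => //.
exact: max0_ge0.
Qed.

HB.instance Definition _ t :=
  isMeasurableFun.Build _ _ _ _ _ (measurable_tpath t).

Lemma measurable_to_natural : measurable_fun setT to_natural.
Proof.
apply: (@measurability _ _ _ natural_space setT _ _ erefl) =>
  // _ [_ [s [H [s0 mH ->]]] <-].
by rewrite setTI; exact: (@path_measurable _ _ _ _ D _ H).
Qed.

HB.instance Definition _ :=
  isMeasurableFun.Build _ _ _ _ _ measurable_to_natural.

Lemma tpath_continuous w : continuous (tpath^~ w : R -> 'rV[R]_n).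
Proof. exact: path_max0_continuous. Qed.

Lemma measurable_tpath_prod :
  measurable_fun setT (fun p : Omega * measurableTypeR R => tpath p.2 p.1).
Proof.
apply: (@measurable_continuous_process _ Omega R n tpath) => //.
exact: tpath_continuous.
Qed.

Lemma measurable_tpath_natural t :
  measurable_fun setT (tpath t : natural_space -> _).
Proof.
move=> _ H mH; rewrite setTI; apply: sub_gen_smallest.
by exists (Num.max 0%R t), H; rewrite max0_ge0.
Qed.

Lemma measurable_tpath_natural_prod :
  measurable_fun setT
    (fun p : natural_space * measurableTypeR R => tpath p.2 p.1).
Proof.
apply: (@measurable_continuous_process _ natural_space R n tpath).
  exact: tpath_continuous.
exact: measurable_tpath_natural.
Qed.

(** Indexing by a starting point and a time makes the kernel yield measurability of [mean_path]
    jointly in both. *)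
Definition natural_law (p : borelRV R n * measurableTypeR R) :
  {measure set natural_space -> \bar R} := distribution (P p.1) to_natural.

Lemma measurable_natural_law (B : set natural_space) : measurable B ->
  measurable_fun setT (natural_law^~ B).
Proof.
move=> mB; apply: (measurableT_comp (f := fun x : borelRV R n => P x B)).
  exact: law_measurable.
exact: measurable_fst.
Qed.

HB.instance Definition _ :=
  isKernel.Build _ _ _ _ _ natural_law measurable_natural_law.

Lemma natural_law_prob p : natural_law p setT = 1.
Proof. exact: probability_setT. Qed.

HB.instance Definition _ :=
  Kernel_isProbability.Build _ _ _ _ _ natural_law natural_law_prob.

(** The transition semigroup of the diffusion applied to [F]. *)
Definition mean_path (F : borelRV R n -> \bar R) (y : borelRV R n) (t : R) :
    \bar R :=
  \int[P y]_w F (tpath t w).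

Section mean_path.
Variable F : borelRV R n -> \bar R.
Hypotheses (mF : measurable_fun setT F) (F0 : forall y, 0 <= F y).

Lemma mean_path_ge0 y t : 0 <= mean_path F y t.
Proof. exact: integral_ge0. Qed.

Lemma measurable_mean_path :
  measurable_fun setT (fun p : borelRV R n * measurableTypeR R =>
    mean_path F p.1 p.2).
Proof.
have mFt : measurable_fun setT
    (fun q : (borelRV R n * measurableTypeR R) * natural_space =>
      F (tpath q.1.2 q.2)).
  have mq : measurable_fun setT
      (fun q : (borelRV R n * measurableTypeR R) * natural_space =>
        (q.2, q.1.2)).
    apply: measurable_fun_pair => //.
    exact: (measurableT_comp measurable_snd measurable_fst).
  exact: (measurableT_comp mF (measurableT_comp measurable_tpath_natural_prod
    mq)).
have := measurable_fun_integral_finite_kernel _ natural_law (fun=> F0 _) mFt.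
congr measurable_fun; apply/funext => -[y t] /=.
rewrite /natural_law /distribution ge0_integral_pushforward//.
exact: (measurableT_comp mF (measurable_tpath_natural t)).
Qed.

Variable r : R.
Hypothesis r_gt0 : (0 < r)%R.

(** The Green kernel is the mixture over time of the laws of the position, scaled by the
    discount. *)
Lemma ge0_integral_green x :
  \int[green D r x]_y F y =
  \int[lebesgue_measure]_t ((discount r t)%:E * mean_path F x t).
Proof.
pose e (t : R) : {nonneg R} := NngNum (expR_ge0 (- r * t)).
have mH H : measurable H ->
  measurable_fun (`[0%R, +oo[%classic : set (measurableTypeR R))
    (fun t => P x (tpath t @^-1` H)).
  move=> mH; apply: eq_measurable_fun (measurable_law_path D x mH) => t.
  by rewrite inE/= in_itv/= andbT /tpath => /max_r ->.
rewrite (@ge0_integral_mixture _ _ _ _ _ _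
    (@lebesgue_measure R) `[0%R, +oo[%classic
    (fun t => mscale (e t) (distribution (P x) (tpath t))))//.
- rewrite integral_mkcond; apply: eq_integral => t _.
  rewrite patchE /discount mem_setE in_itv/= andbT; case: ifPn => t0;
    last by rewrite mul0e.
  rewrite ge0_integral_mscale// /distribution ge0_integral_pushforward//.
- move=> H mH'; apply: emeasurable_funM; last exact: mH.
  by apply/measurable_EFinP; apply: measurableT_comp.
- move=> H mH'; rewrite /green; apply: eq_integral => t.
  rewrite inE/= in_itv/= andbT => t0;
    rewrite /mscale/= /distribution /pushforward.
  by congr (_ * P x _); apply/funext => w; rewrite /preimage /= /tpath max_r.
Qed.

Lemma measurable_integral_green :
  measurable_fun setT (fun x : borelRV R n => \int[green D r x]_y F y).
Proof.
under eq_fun do rewrite ge0_integral_green.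
apply: (measurable_fun_fubini_tonelli_F (m2 := lebesgue_measure)
  (fun p : borelRV R n * measurableTypeR R =>
    (discount r p.2)%:E * mean_path F p.1 p.2)).
  apply: emeasurable_funM; last exact: measurable_mean_path.
  apply/measurable_EFinP; apply: measurableT_comp => //;
    exact: measurable_discount.
by move=> p; rewrite mule_ge0 ?mean_path_ge0// lee_fin discount_ge0.
Qed.

Definition path_integrand (p : Omega * measurableTypeR R) : \bar R :=
  (discount r p.2)%:E * F (tpath p.2 p.1).

Lemma path_integrand_ge0 p : 0 <= path_integrand p.
Proof. by rewrite mule_ge0// lee_fin discount_ge0. Qed.

Lemma measurable_path_integrand : measurable_fun setT path_integrand.
Proof.
apply: emeasurable_funM.
  apply/measurable_EFinP; apply: measurableT_comp => //;
    exact: measurable_discount.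
by apply: measurableT_comp => //; exact: measurable_tpath_prod.
Qed.

(** By Tonelli's theorem the time integral moves inside the expectation, where it can be cut at a
    random time. *)
Lemma ge0_integral_green_path x :
  \int[green D r x]_y F y =
  \int[P x]_w \int[lebesgue_measure]_t path_integrand (w, t).
Proof.
rewrite ge0_integral_green (@fubini_tonelli _ _ _ _ _ (P x) lebesgue_measure
  path_integrand).
- apply: eq_integral => t _; rewrite /path_integrand/= ge0_integralZl//.
  + by apply: measurableT_comp => //; exact: measurable_tpath.
  + by rewrite lee_fin discount_ge0.
- exact: measurable_path_integrand.
- exact: path_integrand_ge0.
Qed.

End mean_path.
End natural_space.

(** * The strong Markov property for the Green kernel *)

Section strong_markov_green.
Local Open Scope ereal_scope.
Context d (Omega : measurableType d) (R : realType) (n : nat).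
Variable D : diffusion Omega R n.
Local Notation P := (law D).
Local Notation X := (Defs.path D).

Lemma measurable_stopping_time tau : stopping_time P X tau ->
  measurable_fun setT tau.
Proof.
move=> [tau0 mtau].
apply: (measurability _ (ErealGenOInfty.measurableE R)) => _ [_ [t ->] <-].
rewrite setTI preimage_itvoy.
have -> : [set w | t%:E < tau w] = ~` [set w | tau w <= t%:E].
  by apply/seteqP; split => w /=; rewrite ltNge => /negP.
apply: measurableC; have [t0|t0] := leP 0%R t.
  exact: (usual_filtration_measurable t0 (mtau t t0)).
rewrite (_ : mkset _ = set0)//; apply/seteqP; split => // w /=.
by rewrite leNgt (lt_le_trans _ (tau0 w)).
Qed.

(** These are the events on which the strong Markov property is applied; intersecting with
    [tau <= t] replaces [u] by [min u t]. *)
Lemma stopped_sigma_le tau u : stopping_time P X tau -> (0 <= u)%R ->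
  stopped_sigma P X tau [set w | tau w <= u%:E].
Proof.
move=> [tau0 mtau] u0; split.
  exact: (usual_filtration_measurable u0 (mtau u u0)).
move=> t t0 mu s ts.
have -> : [set w | tau w <= u%:E] `&` [set w | tau w <= t%:E] =
    [set w | tau w <= (Num.min u t)%:E].
  by apply/seteqP; split => w /=; rewrite EFin_min le_min => /andP.
apply: mtau; first by rewrite le_min u0.
by rewrite gt_min ts orbT.
Qed.

Variable tau : Omega -> \bar R.
Hypothesis tau_stopping : stopping_time P X tau.

Let tau_ge0 w : 0 <= tau w.
Proof. by have [+ _] := tau_stopping; exact. Qed.

Let mtau := measurable_stopping_time tau_stopping.

(** Where [tau] is infinite, [fine] returns [0]; such paths are discarded below by [ediscount] or by
    an event [tau <= u]. *)
Definition path_after (s : R) (w : Omega) : borelRV R n :=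
  tpath D (fine (tau w) + s)%R w.

Lemma measurable_path_after_prod :
  measurable_fun setT (fun p : Omega * measurableTypeR R => path_after p.2 p.1).
Proof.
have mq : measurable_fun setT (fun p : Omega * measurableTypeR R =>
    (p.1, (fine (tau p.1) + p.2)%R : measurableTypeR R)).
  apply: measurable_fun_pair => //; apply: measurable_funD => //.
  by apply: measurableT_comp => //; exact: measurableT_comp.
exact: (measurableT_comp (measurable_tpath_prod D) mq).
Qed.

Lemma measurable_path_after s : measurable_fun setT (path_after s).
Proof.
have mq : measurable_fun setT (fun w : Omega => (w, s : measurableTypeR R)).
  exact: measurable_fun_pair.
exact: (measurableT_comp measurable_path_after_prod mq).
Qed.

Variable F : borelRV R n -> \bar R.
Hypotheses (mF : measurable_fun setT F) (F0 : forall y, 0 <= F y).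

(** The strong Markov property on sets equates a mixture of Dirac masses at the shifted path with a
    mixture of transition laws, and [eq_integral_mixture] extends it to [F]. *)
Lemma strong_markov_mean x u s : (0 <= u)%R -> (0 <= s)%R ->
  \int[P x]_(w in [set w | tau w <= u%:E]) F (path_after s w) =
  \int[P x]_(w in [set w | tau w <= u%:E]) mean_path D F (path_after 0%R w) s.
Proof.
move=> u0 s0; set A := [set w | _].
have [mA _] := stopped_sigma_le tau_stopping u0.
have Afin : A `&` [set w | tau w < +oo] = A.
  by apply/setIidl => w /= /le_lt_trans; apply; rewrite ltry.
have path0 w : path_after 0 w = X (fine (tau w)) w.
  by rewrite /path_after /tpath addr0 max_r// fine_ge0.
have paths w : path_after s w = X (fine (tau w) + s)%R w.
  by rewrite /path_after /tpath max_r// addr_ge0// fine_ge0.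
have tpaths H : tpath D s @^-1` H = X s @^-1` H.
  by apply/funext => w; rewrite /preimage/= /tpath max_r.
transitivity (\int[P x]_(w in A) \int[\d_(path_after s w)]_y F y).
  by apply: eq_integral => w _; rewrite integral_dirac// diracT mul1e.
rewrite (@eq_integral_mixture _ _ _ _ _ _ _ (P x) (P x) A A _
  (fun w => distribution (P (path_after 0%R w)) (tpath D s)) F mA mA)//.
- by apply: eq_integral => w _; rewrite /distribution ge0_integral_pushforward.
- move=> H mH; apply: measurable_funTS; apply/measurable_EFinP.
  by apply: measurableT_comp;
    [exact: measurable_indic|exact: measurable_path_after].
- move=> H mH; apply: measurable_funTS.
  apply: (measurableT_comp (f :=
    fun y : borelRV R n => P y (tpath D s @^-1` H))).
    apply: law_measurable; apply: sub_gen_smallest.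
    by exists s, H; split => //; rewrite tpaths.
  exact: measurable_path_after.
- move=> H mH.
  have := diffusion_strong_markov tau_stopping x s0 mH (stopped_sigma_le
    tau_stopping u0).
  rewrite -/A Afin => SM.
  transitivity (\int[P x]_(w in A) P (X (fine (tau w)) w) (X s @^-1` H));
    last first.
    by apply: eq_integral => w _; rewrite path0; congr (P _ _);
      exact/esym/tpaths.
  rewrite -SM -[LHS]/(\int[P x]_(w in A) (\1_(path_after s @^-1` H) w)%:E).
  rewrite integral_indic//; last first.
    by rewrite -[X in measurable X]setTI; exact: measurable_path_after.
  rewrite setIC; congr (P x _); apply/seteqP; split => w /=; rewrite paths.
    by move=> [Aw Hw]; split => //; split => //;
      rewrite (le_lt_trans Aw)// ltry.
  by move=> [Aw [_ Hw]].
Qed.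

Variable r : R.
Hypothesis r_gt0 : (0 < r)%R.

Let swap x (K : Omega * measurableTypeR R -> \bar R) :
  measurable_fun setT K -> (forall p, 0 <= K p) ->
  \int[P x]_w (ediscount r (tau w) *
    \int[lebesgue_measure]_s ((discount r s)%:E * K (w, s))) =
  \int[lebesgue_measure]_s ((discount r s)%:E *
    \int[P x]_w (ediscount r (tau w) * K (w, s))).
Proof.
move=> mK K0.
have md : measurable_fun setT (fun p : Omega * measurableTypeR R =>
  (discount r p.2)%:E).
  by apply/measurable_EFinP; apply: measurableT_comp => //;
    exact: measurable_discount.
have me : measurable_fun setT (fun w => ediscount r (tau w)).
  by apply: measurableT_comp => //; exact: measurable_ediscount.
pose h p := ediscount r (tau p.1) * ((discount r p.2)%:E * K p).
have mh : measurable_fun setT h.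
  apply: emeasurable_funM; last exact: emeasurable_funM.
  exact: (measurableT_comp me measurable_fst).
have h0 p : 0 <= h p by rewrite !mule_ge0 ?ediscount_ge0// lee_fin discount_ge0.
transitivity (\int[P x]_w \int[lebesgue_measure]_s h (w, s)).
  apply: eq_integral => w _; rewrite /h/= ge0_integralZl//.
  - apply: emeasurable_funM; last exact: measurableT_comp.
    by apply/measurable_EFinP; exact: measurable_discount.
  - by move=> s _; rewrite mule_ge0// lee_fin discount_ge0.
  - exact: ediscount_ge0.
rewrite (@fubini_tonelli _ _ _ _ _ (P x) lebesgue_measure h)//.
apply: eq_integral => s _; rewrite /h/= -ge0_integralZl//.
- by apply: eq_integral => w _; rewrite muleCA.
- by apply: emeasurable_funM => //; exact: measurableT_comp.
- by move=> w _; rewrite mule_ge0// ediscount_ge0.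
- by rewrite lee_fin discount_ge0.
Qed.

(** Substituting [t = tau + s] factors out [e^(-r tau)]. For fixed [s], the Markov property on the
    events [tau <= u] and [integral_ediscount_eq] replace [F] along the path by its mean;
    integrating over [s] reassembles the Green kernel. *)
Lemma strong_markov_green x :
  \int[P x]_w \int[lebesgue_measure]_(t in [set t | tau w <= t%:E])
    path_integrand D F r (w, t) =
  \int[P x]_w (ediscount r (tau w) * \int[green D r (path_after 0%R w)]_y F y).
Proof.
transitivity (\int[P x]_w (ediscount r (tau w) *
    \int[lebesgue_measure]_s ((discount r s)%:E * F (path_after s w)))).
  apply: eq_integral => w _; rewrite /path_integrand/= /path_after.
  case: (tau w) (tau_ge0 w) => [a|_|//]; last first.
    by rewrite mul0e (_ : mkset _ = set0) ?integral_set0//; apply/seteqP; split.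
  rewrite lee_fin => a0 /=.
  rewrite -(@integral_discount_shift _ _ r_gt0 a (fun t => F (tpath D t w)))//.
  - congr integral; apply/seteqP; split => t /=;
    rewrite in_itv/= andbT lee_fin//.
  - have mq : measurable_fun setT (fun t : measurableTypeR R => (w, t)).
      exact: measurable_fun_pair.
    exact: (measurableT_comp mF (measurableT_comp (measurable_tpath_prod D)
      mq)).
under [RHS]eq_integral do rewrite ge0_integral_green//.
have mK1 : measurable_fun setT (fun p : Omega * measurableTypeR R =>
  F (path_after p.2 p.1)).
  exact: measurableT_comp mF measurable_path_after_prod.
have mK2 : measurable_fun setT (fun p : Omega * measurableTypeR R =>
    mean_path D F (path_after 0%R p.1) p.2).
  have mq : measurable_fun setT (fun p : Omega * measurableTypeR R =>
      (path_after 0%R p.1, p.2)).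
    apply: measurable_fun_pair => //.
    exact: (measurableT_comp (measurable_path_after 0%R) measurable_fst).
  exact: (measurableT_comp (measurable_mean_path D mF F0) mq).
rewrite (swap x mK1 (fun p => F0 _)) (swap x mK2 (fun p =>
  mean_path_ge0 D F0 _ _)).
apply: eq_integral => s _ /=.
have [s0|s0] := leP 0%R s; last by rewrite /discount leNgt s0/= !mul0e.
congr (_ * _); apply: integral_ediscount_eq => //.
- exact: measurableT_comp mF (measurable_path_after s).
- have mq : measurable_fun setT (fun w : Omega =>
  (path_after 0%R w, s : measurableTypeR R)).
    apply: measurable_fun_pair => //; exact: measurable_path_after.
  exact: (measurableT_comp (measurable_mean_path D mF F0) mq).
- by move=> w; exact: mean_path_ge0.
- by move=> u u0; exact: strong_markov_mean.
Qed.

End strong_markov_green.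

(* Monotonicity straight from the supremum over simple functions, for use with
   the discounted reward, whose limsup over a continuous time parameter need
   not be measurable. *)
Lemma ge0_le_integral_nomeas d (T : measurableType d) (R : realType)
    (mu : {measure set T -> \bar R}) (f1 f2 : T -> \bar R) :
  (forall x, 0 <= f1 x)%E -> (forall x, f1 x <= f2 x)%E ->
  (\int[mu]_x f1 x <= \int[mu]_x f2 x)%E.
Proof.
move=> f10 f12; have f20 x : (0 <= f2 x)%E by exact: le_trans (f12 x).
rewrite !ge0_integralTE//; apply: ereal_sup_le => _ [h hf1 <-].
by exists h => // x; exact: le_trans (hf1 x) (f12 x).
Qed.

(** * Splitting Green integrals at a stopping time *)

Section before_after.
Local Open Scope ereal_scope.
Context d (Omega : measurableType d) (R : realType) (n : nat).
Variable D : diffusion Omega R n.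
Local Notation P := (law D).
Local Notation X := (Defs.path D).
Local Notation mu := (@lebesgue_measure R).
Variable r : R.
Hypothesis r_gt0 : (0 < r)%R.
Variable tau : Omega -> \bar R.
Hypothesis tau_stopping : stopping_time P X tau.

Definition green_before (F : borelRV R n -> \bar R) (x : 'rV[R]_n) : \bar R :=
  \int[P x]_w \int[mu]_(t in [set t | t%:E < tau w])
    path_integrand D F r (w, t).

Definition green_after (F : borelRV R n -> \bar R) (x : 'rV[R]_n) : \bar R :=
  \int[P x]_w (ediscount r (tau w) *
    \int[green D r (path_after D tau 0%R w)]_y F y).

Let mtau := measurable_stopping_time tau_stopping.

Let tau_ge0 w : 0 <= tau w.
Proof. by have [+ _] := tau_stopping; exact. Qed.

Lemma measurable_before_set (w : Omega) : measurable [set t : R | t%:E < tau w].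
Proof.
by rewrite -[X in measurable X]setTI; apply: measurable_lte => //;
  exact/measurable_EFinP.
Qed.

Lemma measurable_before_graph :
  measurable [set p : Omega * measurableTypeR R | (p.2 : R)%:E < tau p.1].
Proof.
rewrite -[X in measurable X]setTI; apply: measurable_lte => //.
- by apply/measurable_EFinP.
- exact: measurableT_comp.
Qed.

Section ge0.
Variable F : borelRV R n -> \bar R.
Hypotheses (mF : measurable_fun setT F) (F0 : forall y, 0 <= F y).

Lemma measurable_path_integrand_section (w : Omega) :
  measurable_fun setT (fun t : measurableTypeR R =>
    path_integrand D F r (w, t)).
Proof. by apply: measurableT_comp; [exact: measurable_path_integrand|]. Qed.

Lemma measurable_integral_section (E : set (Omega * measurableTypeR R)) :
  measurable E ->
  measurable_fun setT (fun w =>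
    \int[mu]_(t in [set t | E (w, t)]) path_integrand D F r (w, t)).
Proof.
move=> mE.
have := measurable_fun_fubini_tonelli_F (m2 := mu) (path_integrand D F r \_ E).
have mpE : measurable_fun setT (path_integrand D F r \_ E).
  apply: (iffLR (measurable_restrictT _ mE)).
  by apply: measurable_funTS; exact: measurable_path_integrand.
have pE0 p : 0 <= (path_integrand D F r \_ E) p.
  by rewrite patchE; case: ifP => // _; exact: path_integrand_ge0.
move=> /(_ mpE pE0); congr measurable_fun; apply/funext => w.
rewrite [RHS]integral_mkcond; apply: eq_integral => t _; rewrite !patchE.
by rewrite [in RHS](_ : t \in _ = ((w, t) \in E))//;
  apply/idP/idP => /set_mem ?; apply/mem_set.
Qed.

Lemma measurable_before : measurable_fun setT
  (fun w => \int[mu]_(t in [set t | t%:E < tau w]) path_integrand D F r (w, t)).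
Proof. exact: (measurable_integral_section measurable_before_graph). Qed.

Lemma green_before_ge0 x : 0 <= green_before F x.
Proof.
by apply: integral_ge0 => w _; apply: integral_ge0 => t _;
  exact: path_integrand_ge0.
Qed.

Lemma measurable_after : measurable_fun setT
  (fun w => ediscount r (tau w) *
    \int[green D r (path_after D tau 0%R w)]_y F y).
Proof.
apply: emeasurable_funM.
  by apply: measurableT_comp => //; exact: measurable_ediscount.
have mg := measurable_integral_green D mF F0 r_gt0.
exact: (measurableT_comp mg (measurable_path_after tau_stopping 0%R)).
Qed.

Lemma after_ge0 w :
  0 <= ediscount r (tau w) * \int[green D r (path_after D tau 0%R w)]_y F y.
Proof. by rewrite mule_ge0 ?ediscount_ge0// integral_ge0. Qed.

(** The time integral is cut at [tau], and the strong Markov property rewrites the later part. *)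
Lemma integral_green_split x :
  \int[green D r x]_y F y = green_before F x + green_after F x.
Proof.
rewrite ge0_integral_green_path// /green_after -strong_markov_green//.
have mtail : measurable_fun setT (fun w =>
    \int[mu]_(t in [set t | tau w <= t%:E]) path_integrand D F r (w, t)).
  rewrite (_ : (fun _ => _) = fun w => \int[mu]_(t in [set t |
      (~` [set p : Omega * measurableTypeR R | (p.2 : R)%:E < tau p.1]) (w, t)])
      path_integrand D F r (w, t)).
    by apply: measurable_integral_section; apply: measurableC;
      exact: measurable_before_graph.
  by apply/funext => w; congr integral; apply/seteqP; split => t /=;
    rewrite leNgt => /negP.
rewrite -ge0_integralD//; last 3 first.
- by move=> w _; apply: integral_ge0 => t _; exact: path_integrand_ge0.
- exact: measurable_before.
- by move=> w _; apply: integral_ge0 => t _; exact: path_integrand_ge0.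
apply: eq_integral => w _.
have tailE : [set t | tau w <= t%:E] = ~` [set t : R | t%:E < tau w].
  by apply/seteqP; split => t /=; rewrite leNgt => /negP.
rewrite tailE -ge0_integral_setU//.
- by rewrite setUv.
- exact: measurable_before_set.
- by apply: measurableC; exact: measurable_before_set.
- by rewrite setUv; exact: measurable_path_integrand_section.
- by move=> t _; exact: path_integrand_ge0.
- exact/disj_setPCl.
Qed.

Lemma green_before_eq0 x :
  (forall w t, (0 <= t)%R -> t%:E < tau w -> F (X t w) = 0) ->
    green_before F x = 0.
Proof.
move=> Ft0; apply: integral0_eq => w _; apply: integral0_eq => t /= ttau.
rewrite /path_integrand/= /discount; case: ifPn => t0; last by rewrite mul0e.
by rewrite /tpath max_r// Ft0// mule0.
Qed.

(** A vanishing nonnegative integral forces the integrand to vanish, almost surely and then for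
    almost every time before [tau]; it is positive whenever the path is in [B]. *)
Lemma occupation_time_eq0 x (B : set 'rV[R]_n) :
  measurable (B : set (borelRV R n)) ->
  (forall w t, (0 <= t)%R -> t%:E < tau w -> B (X t w) -> 0 < F (X t w)) ->
  green_before F x = 0 ->
  P x [set w | occupation_time D tau B w = 0] = 1.
Proof.
move=> mB FB before0.
(* The sections of [E] measure the occupation time, which is therefore measurable in [w]. *)
pose E := [set p : Omega * measurableTypeR R |
  [/\ (0 <= p.2 :> R)%R, (p.2 : R)%:E <= tau p.1 & B (tpath D p.2 p.1)]].
have mE : measurable E.
  have -> : E = [set p : Omega * measurableTypeR R | (0 <= p.2 :> R)%R] `&`
      [set p : Omega * measurableTypeR R | (p.2 : R)%:E <= tau p.1] `&`
      [set p : Omega * measurableTypeR R | B (tpath D p.2 p.1)].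
    by apply/seteqP; split => p /=; [move=> []|move=> [[]]].
  apply: measurableI; first apply: measurableI.
  - rewrite -[X in measurable X]setTI.
    exact: (measurable_fun_le (f := cst 0%R) (g := snd)).
  - rewrite -[X in measurable X]setTI; apply: measurable_lee => //.
      by apply/measurable_EFinP.
    exact: measurableT_comp.
  - rewrite -[X in measurable X]setTI; exact: measurable_tpath_prod.
have occE w : occupation_time D tau B w = mu (xsection E w).
  congr (mu _); apply/seteqP; split => t /=.
    by move=> [t0 tt Bt]; rewrite /xsection/=; apply/mem_set; split => //=;
      rewrite /tpath max_r.
  by rewrite /xsection/= => /set_mem[/= t0 tt]; rewrite /tpath max_r.
have mocc : measurable_fun setT (occupation_time D tau B).
  have -> : occupation_time D tau B = mu \o xsection E.
    by apply/funext => w; exact: occE.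
  exact: (measurable_fun_xsection mu mE).
have mZ : measurable [set w | occupation_time D tau B w = 0].
  by rewrite -[X in measurable X]setTI;
    exact: (mocc measurableT [set 0] (emeasurable_set1 0)).
have : ae_eq (P x) setT (fun w =>
    \int[mu]_(t in [set t | t%:E < tau w]) path_integrand D F r (w, t)) (cst 0).
  apply/ae_eq_integral_abs => //; first exact: measurable_before.
  rewrite -[RHS]before0; apply: eq_integral => w _; rewrite gee0_abs//.
  by apply: integral_ge0 => t _; exact: path_integrand_ge0.
move=> [N [mN N0 sN]].
suff ZC : P x (~` [set w | occupation_time D tau B w = 0]) = 0.
  by rewrite -[X in P x X]setCK probability_setC ?ZC ?sube0//;
    exact: measurableC.
apply: (subset_measure0 _ mN _ N0); first exact: measurableC.
move=> w /= occ0; apply: sN => /= ae0; apply: occ0; rewrite occE.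
have {}ae0 := ae0 I.
have : ae_eq mu [set t | t%:E < tau w]
    (fun t => path_integrand D F r (w, t)) (cst 0).
  apply/ae_eq_integral_abs; first exact: measurable_before_set.
    by apply: measurable_funTS; exact: measurable_path_integrand_section.
  rewrite -[RHS]ae0; apply: eq_integral => t _; rewrite gee0_abs//.
  exact: path_integrand_ge0.
move=> [M [mM M0 sM]].
(* The occupation time includes [t = tau], which [green_before] leaves out; a single point is
   negligible. *)
apply: (@subset_measure0 _ _ _ mu _ (M `|` [set fine (tau w)])).
- exact: measurable_xsection.
- exact: measurableU.
- move=> t; rewrite /xsection/= => /set_mem[/= t0 tt Bt].
  have [ttau|ttau] := ltP t%:E (tau w).
    left; apply: sM => /= /(_ ttau) /eqP; apply/negP; rewrite gt_eqF//.
    rewrite /path_integrand/= mule_gt0//.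
      by rewrite lte_fin /discount t0 expR_gt0.
    by move: Bt; rewrite /tpath max_r//; exact: FB.
  right; have -> : tau w = t%:E by apply/eqP; rewrite eq_le ttau tt.
  by [].
- rewrite -[LHS]/(mu (M `|` [set fine (tau w)])) measureU0//.
  exact: lebesgue_measure_set1.
Qed.

End ge0.

Lemma green_beforeD (F1 F2 : borelRV R n -> \bar R) x :
  measurable_fun setT F1 -> (forall y, 0 <= F1 y) ->
  measurable_fun setT F2 -> (forall y, 0 <= F2 y) ->
  green_before (fun y => F1 y + F2 y) x = green_before F1 x + green_before F2 x.
Proof.
move=> mF1 F10 mF2 F20.
rewrite /green_before -ge0_integralD//; last 4 first.
- by move=> w _; apply: integral_ge0 => t _; exact: path_integrand_ge0.
- exact: measurable_before.
- by move=> w _; apply: integral_ge0 => t _; exact: path_integrand_ge0.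
- exact: measurable_before.
apply: eq_integral => w _; rewrite -ge0_integralD//.
- by apply: eq_integral => t _; rewrite /path_integrand/= ge0_muleDr.
- exact: measurable_before_set.
- by move=> t _; exact: path_integrand_ge0.
- by apply: measurable_funTS; exact: measurable_path_integrand_section.
- by move=> t _; exact: path_integrand_ge0.
- by apply: measurable_funTS; exact: measurable_path_integrand_section.
Qed.

End before_after.

Lemma closed_borel (R : realType) n (U : set 'rV[R]_n) : closed U ->
  measurable (U : set (borelRV R n)).
Proof.
move=> cU; rewrite -[X in measurable X]setCK; apply: measurableC.
by apply: sub_gen_smallest; exact: closed_openC.
Qed.

(** The finite total [c] makes every term finite, so [b + p = q <= p]. *)
Lemma ereal_squeeze (R : realType) (a b p q : \bar R) (c : R) :
  (0 <= a)%E -> (0 <= b)%E -> (0 <= p)%E -> (0 <= q)%E ->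
  (a + b + p = c%:E)%E -> (a + q = c%:E)%E -> (q <= p)%E -> b = 0%E.
Proof.
case: a b p q => [a||] [b||] [p||] [q||]//.
rewrite -!EFinD !lee_fin => a0 b0 p0 q0 [E1] [E2] qp; congr EFin; lra.
Qed.

(** * Comparison of Green integrals at hitting times *)

Section verification.
Local Open Scope ereal_scope.
Context d (Omega : measurableType d) (R : realType) (n : nat).
Variable D : diffusion Omega R n.
Local Notation P := (law D).
Local Notation X := (Defs.path D).
Variable r : R.
Hypothesis r_gt0 : (0 < r)%R.

Lemma path_after0 tau w : (0 <= tau w) ->
  path_after D tau 0%R w = X (fine (tau w)) w.
Proof. by move=> t0; rewrite /path_after /tpath addr0 max_r// fine_ge0. Qed.

Lemma law_start_ae x : {ae P x, forall w, X 0%R w = x}.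
Proof.
have mx : measurable [set w | X 0%R w = x].
  apply: (@path_measurable _ _ _ _ D _ [set x]) => //.
  apply: closed_borel.
  have := hausdorff_accessible (@norm_hausdorff _ 'rV[R]_n).
  by move=> /accessible_closed_set1; exact.
exists (~` [set w | X 0%R w = x]); split => //; first exact: measurableC.
by rewrite probability_setC// law_start subee.
Qed.

(** Neither function contributes before the exit from [U], so only the Green integrals at the exit
    position count, and almost surely that position is on the boundary. In use, [F1] and [F2] are
    the positive and negative parts of [f] off [U]. *)
Lemma green_boundary_eq (U : set 'rV[R]_n) (F1 F2 : borelRV R n -> \bar R) :
  closed U ->
  measurable_fun setT F1 -> (forall y, 0 <= F1 y) ->
  (forall y, U y -> F1 y = 0) ->
  measurable_fun setT F2 -> (forall y, 0 <= F2 y) ->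
  (forall y, U y -> F2 y = 0) ->
  (forall y, boundary U y ->
    \int[green D r y]_z F1 z = \int[green D r y]_z F2 z) ->
  forall x, U x -> \int[green D r x]_z F1 z = \int[green D r x]_z F2 z.
Proof.
move=> cU mF1 F10 F1U mF2 F20 F2U F12 x Ux.
have st : stopping_time P X (hitting_time D (~` U)).
  by apply: stopping_time_hitting_open; exact: closed_openC.
have splitE (F : borelRV R n -> \bar R) :
    measurable_fun setT F -> (forall y, 0 <= F y) ->
    (forall y, U y -> F y = 0) ->
    \int[green D r x]_z F z = green_after D r (hitting_time D (~` U)) F x.
  move=> mF F0 FU; rewrite (integral_green_split r_gt0 st mF F0).
  rewrite green_before_eq0 ?add0e// => w t t0 tU; apply: FU.
  by apply: contrapT; exact: path_before_hitting tU.
rewrite (splitE F1 mF1 F10 F1U) (splitE F2 mF2 F20 F2U).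
apply: ge0_ae_eq_integral => //.
- exact: (measurable_after r_gt0 st mF1 F10).
- exact: (measurable_after r_gt0 st mF2 F20).
- by move=> w _; exact: after_ge0.
- by move=> w _; exact: after_ge0.
apply: filterS (law_start_ae x) => w Xx _.
have [hfin|] := ltP (hitting_time D (~` U) w) +oo; last first.
  by rewrite leye_eq => /eqP ->; rewrite !mul0e.
rewrite path_after0 ?hitting_time_ge0// F12//.
by apply: path_hitting_boundary => //; rewrite Xx.
Qed.

Lemma discounted_reward_ge (g : 'rV[R]_n -> R) (tau : Omega -> \bar R) w :
  (forall y, (0 <= g y)%R) -> 0 <= tau w ->
  ediscount r (tau w) * (g (X (fine (tau w)) w))%:E <=
    discounted_reward D r g tau w.
Proof.
move=> g0 t0; rewrite /discounted_reward.
case: (tau w) t0 => [t|_|//] /=; last first.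
  (* Every neighbourhood of infinity contains some [M + 1], where the reward is nonnegative; hence
     so is the limsup. *)
  rewrite mul0e; apply: le_ereal_inf_tmp => _ [V [M [_ MV]] <-].
  have VM : V (M + 1)%R by apply: MV; rewrite ltrDl.
  apply: (@le_trans _ _ (expR (- r * (M + 1)) * g (X (M + 1)%R w))%:E).
    by rewrite lee_fin mulr_ge0// expR_ge0.
  by apply: ereal_sup_ubound; exists (M + 1)%R.
by rewrite lee_fin /discount => ->.
Qed.

(** The path hits the closed set [C] inside [C], so the left side is bounded by the expected reward
    of stopping there, one competitor in the supremum. *)
Lemma green_after_le_value (g : 'rV[R]_n -> R) (g0 : forall y, (0 <= g y)%R)
    (C : set 'rV[R]_n) (F : borelRV R n -> \bar R) x :
  closed C -> measurable_fun setT F -> (forall y, 0 <= F y) ->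
  (forall y, C y -> \int[green D r y]_z F z = (g y)%:E) ->
  green_after D r (hitting_time D C) F x <= value_function D r g x.
Proof.
move=> cC mF F0 FC; have st := stopping_time_hitting_closed D cC.
apply: (@le_trans _ _ (expected_reward D r g (hitting_time D C) x)); last first.
  by apply: ereal_sup_ubound; exists (hitting_time D C).
apply: ge0_le_integral_nomeas; first by move=> w; exact: after_ge0.
move=> w; apply: le_trans (discounted_reward_ge g0 (hitting_time_ge0 D C w)).
have [hoo|hfin] := eqVneq (hitting_time D C w) +oo.
  by rewrite hoo !mul0e.
have {}hfin : hitting_time D C w < +oo by rewrite lt_neqAle hfin leey.
rewrite path_after0 ?hitting_time_ge0// FC//.
by apply: cC; exact: hitting_time_closure.
Qed.

Lemma green_after_ge0 tau (F : borelRV R n -> \bar R) x :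
  (forall y, 0 <= F y) -> 0 <= green_after D r tau F x.
Proof. by move=> F0; apply: integral_ge0 => w _; exact: after_ge0. Qed.

(** Both totals equal [c] and share the part of [F1] before [tau]. The part after [tau] is at least
    as large with [F2] as with [F3], which leaves no room for [F2] before [tau]. *)
Lemma green_before_squeeze tau (F1 F2 F3 : borelRV R n -> \bar R) x c :
  stopping_time P X tau ->
  measurable_fun setT F1 -> (forall y, 0 <= F1 y) ->
  measurable_fun setT F2 -> (forall y, 0 <= F2 y) ->
  measurable_fun setT F3 -> (forall y, 0 <= F3 y) ->
  (forall w t, (0 <= t)%R -> t%:E < tau w -> F3 (X t w) = 0) ->
  (forall y, \int[green D r y]_z (F1 z + F3 z) <=
    \int[green D r y]_z (F1 z + F2 z)) ->
  \int[green D r x]_z (F1 z + F2 z) = c%:E ->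
  \int[green D r x]_z (F1 z + F3 z) = c%:E ->
  green_before D r tau F2 x = 0.
Proof.
move=> st mF1 F10 mF2 F20 mF3 F30 F3tau F32.
have F12_ge0 y : 0 <= F1 y + F2 y by rewrite adde_ge0.
have F13_ge0 y : 0 <= F1 y + F3 y by rewrite adde_ge0.
have mF12 : measurable_fun setT (fun y => F1 y + F2 y).
  exact: emeasurable_funD.
have mF13 : measurable_fun setT (fun y => F1 y + F3 y).
  exact: emeasurable_funD.
rewrite (integral_green_split r_gt0 st mF12 F12_ge0).
rewrite (integral_green_split r_gt0 st mF13 F13_ge0).
rewrite (green_beforeD r_gt0 st x mF1 F10 mF2 F20).
rewrite (green_beforeD r_gt0 st x mF1 F10 mF3 F30).
rewrite (green_before_eq0 r x F3tau) adde0 => E12 E13.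
apply: (ereal_squeeze (green_before_ge0 D r tau F10 x)
  (green_before_ge0 D r tau F20 x) (green_after_ge0 tau x F12_ge0)
  (green_after_ge0 tau x F13_ge0) E12 E13).
apply: ge0_le_integral_nomeas; first by move=> w; exact: after_ge0.
by move=> w; apply: lee_wpmul2l; [exact: ediscount_ge0|exact: F32].
Qed.

(** The parts after [tau] coincide and [F1] has none before, so the finite total of [F1] leaves
    nothing for [F2] before [tau]. *)
Lemma green_before_eq0_le tau (F1 F2 : borelRV R n -> \bar R) x :
  stopping_time P X tau ->
  measurable_fun setT F1 -> (forall y, 0 <= F1 y) ->
  measurable_fun setT F2 -> (forall y, 0 <= F2 y) ->
  (forall w t, (0 <= t)%R -> t%:E < tau w -> F1 (X t w) = 0) ->
  (forall w, tau w < +oo ->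
    \int[green D r (X (fine (tau w)) w)]_z F1 z =
      \int[green D r (X (fine (tau w)) w)]_z F2 z) ->
  \int[green D r x]_z F1 z \is a fin_num ->
  \int[green D r x]_z F2 z <= \int[green D r x]_z F1 z ->
  green_before D r tau F2 x = 0.
Proof.
move=> st mF1 F10 mF2 F20 F1tau F12.
rewrite (integral_green_split r_gt0 st mF1 F10).
rewrite (integral_green_split r_gt0 st mF2 F20).
rewrite (green_before_eq0 r x F1tau) add0e.
have -> : green_after D r tau F2 x = green_after D r tau F1 x.
  apply: eq_integral => w _.
  have [hoo|hfin] := eqVneq (tau w) +oo; first by rewrite hoo !mul0e.
  rewrite path_after0; last by have [+ _] := st; exact.
  by rewrite F12// lt_neqAle hfin leey.
have := green_before_ge0 D r tau F20 x.
case: (green_after _ _ _ _ _) => [a| |]//;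
  case: (green_before _ _ _ _ _) => [b| |]//.
rewrite -EFinD !lee_fin gerDr => bge0 _ ble0; congr EFin; apply/eqP.
by rewrite eq_le ble0.
Qed.

End verification.

(** * Characterization of the stopping set by the boundary equation *)

Local Open Scope ereal_scope.

Theorem theorem2p5 (disp : measure_display) (Omega : measurableType disp)
  (R : realType) (d : nat) (hd : (0 < d)%N)
  (D : diffusion Omega R d)
  (r : R) (hr : (0 < r)%R)
  (g : 'rV[R]_d -> R) (g_cont : continuous g) (g_ge0 : forall x, (0 <= g x)%R)
  (f : 'rV[R]_d -> R) (f_cont : continuous f)
  (f_int : forall x, (green D r x).-integrable [set: borelRV R d] (EFin \o f))
  (g_green : forall x, (g x)%:E = \int[green D r x]_y (f y)%:E)
  (V_green : forall x, value_function D r g x =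
     \int[green D r x]_(y in stopping_set D r g) (f y)%:E)
  (hS_opt : optimal_stopping_time D r g
     (hitting_time D (stopping_set D r g)))
  (UU : set (set 'rV[R]_d))
  (UU_ne_closed : forall U, UU U -> U !=set0 /\ closed U)
  (UU_S : UU (stopping_set D r g))
  (cond_a : forall U, UU U -> forall y, U y -> (0 < f y)%R)
  (cond_b_i : forall U U', UU U -> UU U' ->
     (forall x, (U `&` U') x ->
        law D x [set w |
          occupation_time D (hitting_time D (~` U)) (~` U') w = 0] = 1) ->
     U `<=` U')
  (cond_b_ii : forall U U', UU U -> UU U' ->
     (forall x, (~` U) x ->
        law D x [set w |
          occupation_time D (hitting_time D U) U' w = 0] = 1) ->
     U' `<=` U) :
  (forall x, boundary (stopping_set D r g) x ->
     \int[green D r x]_(y in ~` stopping_set D r g) (f y)%:E = 0) /\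
  (forall U, UU U ->
     (forall x, boundary U x -> \int[green D r x]_(y in ~` U) (f y)%:E = 0) ->
     U = stopping_set D r g).
Proof.
set S := stopping_set D r g.
have clU U : UU U -> closed U by move=> /UU_ne_closed[].
have mU U : UU U -> measurable (U : set (borelRV R d)).
  by move=> /clU; exact: closed_borel.
have f_meas : measurable_fun [set: borelRV R d] (EFin \o f).
  exact: measurable_int (f_int 0%R).
(* Cutting [f] off outside [A] gives a function on the whole space, nonnegative when [f > 0] on [A],
   as the lemmas on splitting demand. *)
pose Fp (A : set 'rV[R]_d) : borelRV R d -> \bar R :=
  (EFin \o f : borelRV R d -> \bar R) \_ A.
have FpE (A : set (borelRV R d)) x :
    \int[green D r x]_(y in A) (f y)%:E = \int[green D r x]_y Fp A y.
  exact: integral_mkcond.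
have mFp (A : set (borelRV R d)) : measurable A -> measurable_fun setT (Fp A).
  by move=> mA; apply: (iffLR (measurable_restrictT _ mA));
    exact: measurable_funTS.
have Fp_ge0 (A : set 'rV[R]_d) : (forall y, A y -> (0 < f y)%R) ->
  forall y, 0 <= Fp A y.
  by move=> fA y; rewrite /Fp patchE; case: ifPn => // /set_mem Ay;
    rewrite lee_fin ltW ?fA.
have Fp_gt0 (A : set 'rV[R]_d) y : (forall y, A y -> (0 < f y)%R) -> A y ->
  0 < Fp A y.
  by move=> fA Ay; rewrite /Fp patchE mem_set// lte_fin fA.
have Fp_out (A : set 'rV[R]_d) y : ~ A y -> Fp A y = 0.
  by move=> nAy; rewrite /Fp patchE memNset.
have Fp_in (A : set 'rV[R]_d) y : A y -> Fp A y = (f y)%:E.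
  by move=> Ay; rewrite /Fp patchE mem_set.
have FpD (A B : set 'rV[R]_d) y : Fp A y = Fp (A `&` B) y + Fp (A `\` B) y.
  have [Ay|nAy] := pselect (A y); last first.
    by rewrite !Fp_out ?adde0// => -[].
  have [By|nBy] := pselect (B y).
    by rewrite (Fp_in (A `&` B))// (Fp_out (A `\` B)) ?adde0 ?Fp_in// => -[].
  by rewrite (Fp_in (A `\` B))// (Fp_out (A `&` B)) ?add0e ?Fp_in// => -[].
have g_split (U : set (borelRV R d)) x : measurable U ->
    (g x)%:E = \int[green D r x]_(y in U) (f y)%:E +
      \int[green D r x]_(y in ~` U) (f y)%:E.
  move=> mU'; rewrite g_green -integral_setU ?setUv//; first exact: measurableC.
  exact/disj_setPCl.
have fin_int (A : set (borelRV R d)) x : measurable A ->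
    \int[green D r x]_(y in A) (f y)%:E \is a fin_num.
  move=> mA; apply: integrable_fin_num => //.
  exact: (integrableS measurableT mA (@subsetT _ _) (f_int x)).
split.
  (* Boundary points lie in the closed set [S], where [V = g]; subtracting the finite integral over
     [S] leaves [0] on the complement. *)
  move=> x [Sx _]; have {}Sx : S x by exact: (clU _ UU_S) Sx.
  have := g_split S x (mU _ UU_S); rewrite -V_green Sx.
  move: (fin_int (~` S) x (measurableC (mU _ UU_S))).
  case: (integral _ _ _) => [c|//|//] _; rewrite -EFinD => -[/esym/eqP].
  by rewrite addrC -subr_eq0 addrK => /eqP ->.
move=> U UUU Ubd.
have mCU : measurable (~` U : set (borelRV R d)).
  by apply: measurableC; exact: mU.
have fU := cond_a _ UUU; have fS := cond_a _ UU_S.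
have VSE x : value_function D r g x = \int[green D r x]_y Fp S y.
  by rewrite V_green FpE.
have gV x : U x -> \int[green D r x]_y Fp U y = (g x)%:E.
  move=> Ux; rewrite -FpE (g_split U x (mU _ UUU)).
  rewrite [X in _ = _ + X](_ : _ = 0) ?adde0//.
  have int_Fp y : (green D r y).-integrable setT (Fp (~` U)).
    by apply: (iffLR (integrable_mkcond _ mCU)) => //;
      exact: (integrableS measurableT mCU (@subsetT _ _) (f_int y)).
  rewrite FpE integralE.
  (* Off [U] the sign of [f] is unknown, so the boundary equation is read as equality of the
     integrals of its positive and negative parts. *)
  rewrite (@green_boundary_eq _ _ _ _ D r hr U _ (Fp (~` U))^\-)//.
  - by rewrite subee//; exact: (integrable_neg_fin_num measurableT (int_Fp x)).
  - exact: clU.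
  - by apply: measurable_funepos; exact: mFp.
  - by move=> y Uy; rewrite funeposE Fp_out// maxxx.
  - by apply: measurable_funeneg; exact: mFp.
  - by move=> y Uy; rewrite funenegE Fp_out// oppe0 maxxx.
  - move=> y /Ubd; rewrite FpE integralE => /eqP.
    have fpos := integrable_pos_fin_num measurableT (int_Fp y).
    have fneg := integrable_neg_fin_num measurableT (int_Fp y).
    by rewrite sube_eq ?add0e// ?fin_num_adde_defl// => /eqP.
have mFU := mFp U (mU _ UUU); have mFS := mFp S (mU _ UU_S).
have FU0 := Fp_ge0 U fU; have FS0 := Fp_ge0 S fS.
have V_le x : \int[green D r x]_y Fp U y <= \int[green D r x]_y Fp S y.
  have st := stopping_time_hitting_closed D (clU _ UUU).
  rewrite -VSE (integral_green_split hr st)//.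
  rewrite green_before_eq0 ?add0e.
    by apply: green_after_le_value => //; exact: clU.
  by move=> w t t0 tU; apply: Fp_out; exact: path_before_hitting tU.
have SU : S `<=` U.
  apply: (cond_b_i _ _ UU_S UUU) => x [Sx Ux].
  have st : stopping_time (law D) (Defs.path D) (hitting_time D (~` S)).
    by apply: stopping_time_hitting_open; apply: closed_openC; exact: clU.
  have inS w t : (0 <= t)%R -> t%:E < hitting_time D (~` S) w ->
      S (Defs.path D t w).
    by move=> t0 tS; apply: contrapT; exact: path_before_hitting tS.
  have fI y : (S `&` U) y -> (0 < f y)%R by move=> [/fS].
  have fSmU y : (S `\` U) y -> (0 < f y)%R by move=> [/fS].
  have fUmS y : (U `\` S) y -> (0 < f y)%R by move=> [/fU].
  have mI := mFp _ (measurableI _ _ (mU _ UU_S) (mU _ UUU)).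
  have mSmU := mFp _ (measurableD (mU _ UU_S) (mU _ UUU)).
  have mUmS := mFp _ (measurableD (mU _ UUU) (mU _ UU_S)).
  have FSE : Fp S = fun y => Fp (S `&` U) y + Fp (S `\` U) y.
    by apply/funext => y; exact: FpD.
  have FUE : Fp U = fun y => Fp (S `&` U) y + Fp (U `\` S) y.
    by apply/funext => y; rewrite setIC; exact: FpD.
  (* Before leaving [S], being outside [U] means being in [S \ U]. *)
  apply: (occupation_time_eq0 hr st mSmU (Fp_ge0 _ fSmU) mCU).
    by move=> w t t0 tS nU; apply: Fp_gt0 => //; split => //; exact: inS tS.
  (* The three functions are [f] on the common part, on [S \ U] and on [U \ S]; the last vanishes
     along the path until it exits [S]. *)
  apply: (green_before_squeeze hr st mI (Fp_ge0 _ fI) mSmU (Fp_ge0 _ fSmU)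
    mUmS (Fp_ge0 _ fUmS) (c := g x)).
  - by move=> w t t0 tS; apply: Fp_out => -[_]; apply; exact: inS tS.
  - by move=> y; rewrite -FSE -FUE; exact: V_le.
  - by rewrite -FSE -VSE Sx.
  - by rewrite -FUE; exact: gV.
rewrite eqEsubset; split; last exact: SU.
apply: (cond_b_ii _ _ UU_S UUU) => x _.
have st := stopping_time_hitting_closed D (clU _ UU_S).
apply: (occupation_time_eq0 hr st mFU FU0 (mU _ UUU)).
  by move=> w t _ _; exact: Fp_gt0.
apply: (green_before_eq0_le hr st mFS FS0 mFU FU0).
- by move=> w t t0 tS; apply: Fp_out; exact: path_before_hitting tS.
(* The hitting position is in [S], hence in [U] by [SU], and both integrals equal [g] there. *)
- move=> w hfin.
  have Sw : S (Defs.path D (fine (hitting_time D S w)) w).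
    by have := clU _ UU_S; apply; exact: hitting_time_closure.
  by rewrite gV; [rewrite -VSE Sw|exact: SU].
- by rewrite -FpE; apply: fin_int; exact: mU.
- exact: V_le.
Qed.
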